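(* Let $(s_k)_{k\in\mathbb{N}}\subset(0,1/2)$ be a sequence with $s_k\to 1/2$, and let $\mathfrak{E}_k\in\mathscr{A}_m^{s_k}(\Omega)$, $k\in\mathbb{N}$, be such that $$\sup_{k\in\mathbb{N}}\,(1-2s_k)\,\mathscr{E}_{2s_k}^{\boldsymbol{\sigma}}(\mathfrak{E}_k,\Omega')<\infty\qquad\text{for every open set }\Omega'\Subset\Omega .$$ Then $\{\mathfrak{E}_k\}_{k\in\mathbb{N}}$ is relatively compact in $[L^1_{\rm loc}(\Omega)]^m$, and any accumulation point $\mathfrak{E}$ is a Caccioppoli partition of $\Omega'$ for every open subset $\Omega'\Subset\Omega$.
   Context: Fix integers $n\ge 2$, $m\ge 3$, a bounded open set $\Omega\subset\mathbb{R}^n$ with Lipschitz boundary, and a matrix $\boldsymbol{\sigma}=(\sigma_{ij})\in\mathscr{S}_m$, where $\mathscr{S}_m$ is the set of real symmetric $m\times m$ matrices with $\sigma_{ii}=0$ and $\sigma_{ij}>0$ for $i\ne j$. $A^c$ is the complement of $A$ in $\mathbb{R}^n$, $|\cdot|$ is Lebesgue measure, $\chi_A$ is the characteristic function of $A$, and $\Subset$ means compact inclusion. A partition of $\mathbb{R}^n$ (resp. of an open set $O$) is a collection $\mathfrak{E}=(E_1,\dots,E_m)$ of measurable subsets of $\mathbb{R}^n$ (resp. of $O$) with $|E_i\cap E_j|=0$ for $i\neq j$ and $|\mathbb{R}^n\setminus\bigcup_iE_i|=0$ (resp. $|O\setminus\bigcup_iE_i|=0$). It is a Caccioppoli partition of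 $O$ if moreover each $E_i$ has finite perimeter in $O$. A partition of a larger set is identified with its restriction $(E_i\cap O)_i$ when considered in $O$. A partition $\mathfrak{E}$ is identified with $(\chi_{E_1},\dots,\chi_{E_m})$, so that convergence in $[L^1_{\rm loc}(\Omega)]^m$ means convergence of each $\chi_{E_{i,k}}$ in $L^1_{\rm loc}(\Omega)$. For measurable $A,B\subset\mathbb{R}^n$ and $s\in(0,1/2)$, $\mathcal{I}_{2s}(A,B):=\iint_{A\times B}\frac{dx\,dy}{|x-y|^{n+2s}}$. For an open set $O$ and a partition $\mathfrak{E}$ of $\mathbb{R}^n$, $$\mathscr{E}_{2s}^{\boldsymbol{\sigma}}(\mathfrak{E},O):=\frac12\sum_{i,j=1}^m\sigma_{ij}\,\mathcal{I}_{2s}(E_i\cap O,E_j\cap O),$$ $$\mathscr{F}_{2s}^{\boldsymbol{\sigma}}(\mathfrak{E},O):=\frac12\sum_{i,j=1}^m\sigma_{ij}\big[\mathcal{I}_{2s}(E_i\cap O,E_j\cap O^c)+\mathcal{I}_{2s}(E_i\cap O^c,E_j\cap O)\big],$$ $\mathscr{P}_{2s}^{\boldsymbol{\sigma}}:=\mathscr{E}_{2s}^{\boldsymbol{\sigma}}+\mathscr{F}_{2s}^{\boldsymbol{\sigma}}$, and $\mathscr{A}_m^s(O)$ is the set of partitions $\mathfrak{E}$ of $\mathbb{R}^n$ (with $m$ chambers) such that $\mathscr{P}_{2s}^{\boldsymbol{\sigma}}(\mathfrak{E},O)<\infty$. *)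

(* Defs.v *)
From HB Require Import structures.
From mathcomp Require Import all_boot all_order all_algebra.
From mathcomp Require Import all_classical all_reals all_analysis.
From mathcomp Require Import measurable_realfun.
Import Order.TTheory GRing.Theory Num.Theory.
Import numFieldNormedType.Exports.

Set Implicit Arguments.
Unset Strict Implicit.
Unset Printing Implicit Defensive.

Local Open Scope classical_set_scope.
Local Open Scope ring_scope.

Section borel_rV.
Context {R : realType} {n : nat}.

Let coord (i : 'I_n) (x : 'rV[R]_n) : R := x ord0 i.

Let borel_set0 : g_sigma_preimage coord set0.
Proof. exact: sigma_algebra0. Qed.

Let borel_setC A : g_sigma_preimage coord A -> g_sigma_preimage coord (~` A).
Proof. exact: sigma_algebraC. Qed.

Let borel_bigcup (F : (set 'rV[R]_n)^nat) :
  (forall i, g_sigma_preimage coord (F i)) ->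
  g_sigma_preimage coord (\bigcup_i (F i)).
Proof. exact: sigma_algebra_bigcup. Qed.

(* The Borel sigma-algebra of R^n, as the product sigma-algebra. *)
HB.instance Definition _ := @isMeasurable.Build default_measure_display
  'rV[R]_n (g_sigma_preimage coord) borel_set0 borel_setC borel_bigcup.

Lemma measurable_coord (i : 'I_n) :
  measurable_fun [set: 'rV[R]_n] (fun x : 'rV[R]_n => x ord0 i : R).
Proof.
move=> _ Y mY; apply: sub_sigma_algebra.
by rewrite (bigD1 i)//=; left; exists Y.
Qed.

Lemma measurable_rV d (T : measurableType d) (f : T -> 'rV[R]_n) :
  (forall i, measurable_fun [set: T] (fun t => f t ord0 i : R)) ->
  measurable_fun [set: T] f.
Proof.
move=> mf _ Y; rewrite setTI.
suff: g_sigma_preimage coord `<=` [set Y | measurable (f @^-1` Y)] by apply.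
apply: smallest_sub.
  split=> [|A|F] /=.
  - by rewrite preimage_set0; exact: measurable0.
  - by move=> mA; rewrite setTD preimage_setC; exact: measurableC.
  - by move=> mF; rewrite preimage_bigcup; exact: bigcup_measurable.
apply: (big_ind (fun X => X `<=` _)) => //.
- by move=> A B sA sB x [/sA|/sB].
- move=> i _ _ [B mB <-] /=; rewrite setTI -comp_preimage.
  by rewrite -[X in measurable X]setTI; exact: mf.
Qed.

Lemma measurable_box (A : 'I_n -> set R) : (forall i, measurable (A i)) ->
  measurable [set x : 'rV[R]_n | forall i, A i (x ord0 i)].
Proof.
move=> mA; rewrite (_ : mkset _ =
    \bigcap_(i in [set: 'I_n]) ((fun x : 'rV[R]_n => x ord0 i) @^-1` A i)); last first.
  by apply/seteqP; split=> x /= Ax i; [move=> _|]; exact: Ax.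
apply: fin_bigcap_measurable; first exact: finite_finset.
move=> i _; rewrite -[X in measurable X]setTI.
exact: measurable_coord.
Qed.

Lemma open_measurable_rV (A : set 'rV[R]_n) : open A -> measurable A.
Proof.
move=> oA.
pose box (q : 'rV[rat]_n) (k : nat) := [set x : 'rV[R]_n |
  forall i, `](ratr (q ord0 i) - k.+1%:R^-1), (ratr (q ord0 i) + k.+1%:R^-1)[%classic
              (x ord0 i)].
have -> : A = \bigcup_(q in [set: 'rV[rat]_n])
    \bigcup_(k in [set k | box q k `<=` A]) box q k.
  apply/seteqP; split=> [x Ax|x [q _ [k /= qA]]]; last exact: qA.
  have [e /= e0 xeA] : exists2 e : R, 0 < e & ball x e `<=` A.
    by apply/nbhs_ballP; move: oA; rewrite openE => /(_ _ Ax).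
  have [k ke] : exists k, k.+1%:R^-1 < e / 2.
    have e20 : 0 < e / 2 by rewrite divr_gt0.
    have := near_infty_natSinv_lt (PosNum e20).
    by move=> [N _ /(_ N (leqnn N))] /= ?; exists N.
  have /choice[q xq] (i : 'I_n) : exists q : rat,
      `|x ord0 i - ratr q| < k.+1%:R^-1.
    have : x ord0 i - k.+1%:R^-1 < x ord0 i + k.+1%:R^-1.
      by rewrite ltrBlDr -addrA ltrDl addr_gt0.
    move=> /rat_in_itvoo[q]; rewrite in_itv/= => /andP[q1 q2].
    by exists q; rewrite distrC ltr_distl q1 q2.
  exists (\row_i q i) => //; exists k => /=.
    move=> y qy; apply: xeA; split => // i j; rewrite ord1.
    rewrite /ball/= .
    have := qy j; rewrite mxE /= in_itv/= -ltr_distl distrC => yq.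
    rewrite (le_lt_trans (ler_distD (ratr (q j)) _ _))// (splitr e) ltrD//.
      exact: lt_trans (xq j) ke.
    exact: lt_trans yq ke.
  by move=> i; rewrite mxE /= in_itv/= -ltr_distl; exact: xq.
apply: countable_bigcupT_measurable; first exact: countableP.
move=> q; apply: bigcup_measurable => k _.
apply: (@measurable_box (fun i =>
  `](ratr (q ord0 i) - k.+1%:R^-1), (ratr (q ord0 i) + k.+1%:R^-1)[%classic)).
by move=> i; exact: measurable_itv.
Qed.

End borel_rV.

Section borel_lebesgue.
Context {R : realType}.
Local Open Scope ereal_scope.

Definition cons_rV n (z : R * 'rV[R]_n) : 'rV[R]_n.+1 :=
  row_mx (const_mx z.1 : 'rV_1) z.2.

Lemma cons_rV0 n (z : R * 'rV[R]_n) : cons_rV z ord0 ord0 = z.1.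
Proof.
rewrite /cons_rV (_ : ord0 = lshift n (ord0 : 'I_1)); last exact/val_inj.
by rewrite (row_mxEl (const_mx z.1 : 'rV_1)) mxE.
Qed.

Lemma cons_rVS n (z : R * 'rV[R]_n) (i : 'I_n) :
  cons_rV z ord0 (lift ord0 i) = z.2 ord0 i.
Proof.
rewrite /cons_rV (_ : lift ord0 i = rshift 1 i); last exact/val_inj.
by rewrite (row_mxEr (const_mx z.1 : 'rV_1)).
Qed.

Definition uncons_rV n (x : 'rV[R]_n.+1) : R * 'rV[R]_n :=
  (x ord0 ord0, \row_i x ord0 (lift ord0 i)).

Lemma cons_rVK n : cancel (@cons_rV n) (@uncons_rV n).
Proof.
move=> [x y]; rewrite /uncons_rV cons_rV0; congr pair.
by apply/rowP => i; rewrite mxE cons_rVS.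
Qed.

Lemma measurable_cons_rV n : measurable_fun [set: R * 'rV[R]_n] (@cons_rV n).
Proof.
apply: measurable_rV => i; case: (unliftP ord0 i) => [j|] ->.
  under eq_fun do rewrite cons_rVS.
  exact: (measurableT_comp (measurable_coord j) measurable_snd).
by under eq_fun do rewrite cons_rV0; exact: measurable_fst.
Qed.

Section step.
Context {n : nat} (mu : {sigma_finite_measure set 'rV[R]_n -> \bar R}).

Definition cons_measure : set 'rV[R]_n.+1 -> \bar R :=
  pushforward (@lebesgue_measure R \x mu) (@cons_rV n).

Let measurable_cons_preimage A :
  measurable A -> measurable (@cons_rV n @^-1` A).
Proof.
move=> mA; rewrite -[X in measurable X]setTI.
exact: (@measurable_cons_rV n measurableT).
Qed.

Let cons_measure0 : cons_measure set0 = 0.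
Proof. by rewrite /cons_measure /pushforward preimage_set0 measure0. Qed.

Let cons_measure_ge0 A : 0 <= cons_measure A.
Proof. by rewrite /cons_measure /pushforward; exact: measure_ge0. Qed.

Let cons_measure_sigma_additive : semi_sigma_additive cons_measure.
Proof.
move=> F mF tF mUF; rewrite /cons_measure /pushforward preimage_bigcup.
apply: measure_semi_sigma_additive.
- by move=> i; exact: measurable_cons_preimage.
- apply/trivIsetP => /= i j _ _ ij; rewrite -preimage_setI.
  by move/trivIsetP : tF => /(_ _ _ _ _ ij) ->//; rewrite preimage_set0.
- by rewrite -preimage_bigcup; exact: measurable_cons_preimage.
Qed.

HB.instance Definition _ := isMeasure.Build _ _ _ cons_measure
  cons_measure0 cons_measure_ge0 cons_measure_sigma_additive.

Lemma cons_measureE (A : set R) (B : set 'rV[R]_n) :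
  measurable A -> measurable B ->
  cons_measure [set x : 'rV[R]_n.+1 | A (x ord0 ord0) /\ B (\row_i x ord0 (lift ord0 i))] =
  lebesgue_measure A * mu B.
Proof.
move=> mA mB; rewrite /cons_measure /pushforward.
rewrite (_ : _ @^-1` _ = A `*` B); first exact: product_measure1E.
by apply/seteqP; split=> z /=; rewrite -[z in A z.1 /\ B z.2]cons_rVK.
Qed.

Let cons_measure_sigma_finite : sigma_finite setT cons_measure.
Proof.
have /sigma_finiteP[F [FT ndF Foo]] := sigma_finiteT (@lebesgue_measure R).
have /sigma_finiteP[G [GT ndG Goo]] := sigma_finiteT mu.
exists (fun k => [set x : 'rV[R]_n.+1 | F k (x ord0 ord0) /\
                          G k (\row_i x ord0 (lift ord0 i))]).
  apply/esym; rewrite -subTset => x _.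
  have [k _ Fx] : (\bigcup_k F k) (x ord0 ord0) by rewrite -FT.
  have [l _ Gx] : (\bigcup_k G k) (\row_i x ord0 (lift ord0 i)) by rewrite -GT.
  exists (maxn k l) => //; split.
  - by move: Fx; exact/subsetPset/ndF/leq_maxl.
  - by move: Gx; exact/subsetPset/ndG/leq_maxr.
move=> k; have [mF Fk] := Foo k; have [mG Gk] := Goo k; split.
  rewrite -[X in measurable X]setTI.
  suff mun : measurable_fun [set: 'rV[R]_n.+1] (@uncons_rV n).
    exact: (mun measurableT (F k `*` G k) (measurableX mF mG)).
  apply/measurable_fun_pairP; split; first exact: measurable_coord.
  apply: measurable_rV => i.
  rewrite /comp /=; under eq_fun do rewrite mxE.
  exact: measurable_coord.
by rewrite cons_measureE// lte_mul_pinfty// ge0_fin_numE.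
Qed.

HB.instance Definition _ := Measure_isSigmaFinite.Build _ _ _ cons_measure
  cons_measure_sigma_finite.

End step.

(* The n-fold product of the one-dimensional Lebesgue measure. *)
Fixpoint borel_lebesgue n : {sigma_finite_measure set 'rV[R]_n -> \bar R} :=
  if n is n'.+1 return {sigma_finite_measure set 'rV[R]_n -> \bar R}
  then cons_measure (borel_lebesgue n')
  else @dirac _ 'rV[R]_0 0%R R.

Lemma borel_lebesgue_box n (A : 'I_n -> set R) :
  (forall i, measurable (A i)) ->
  borel_lebesgue n [set x | forall i, A i (x ord0 i)] =
  \prod_(i < n) lebesgue_measure (A i).
Proof.
elim: n A => [|n IH] A mA.
  by rewrite big_ord0 /= diracE mem_set//= => -[].
rewrite big_ord_recl -IH; last by move=> i; exact: mA.
rewrite -cons_measureE//; last first.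
  by apply: (@measurable_box _ _ (fun i => A (lift ord0 i))) => i; exact: mA.
congr (_ _); apply/seteqP; split=> x /=.
  by move=> Ax; split => // i; rewrite mxE.
move=> [A0 AS] i; case: (unliftP ord0 i) => [j|] -> //.
by have := AS j; rewrite mxE.
Qed.

End borel_lebesgue.

Section lebesgue.
Context {R : realType}.
Local Open Scope ereal_scope.

(* R^n with its Lebesgue measurable sets: the Caratheodory sigma-algebra of
   borel_lebesgue, that is, the completion of the Borel sigma-algebra. *)
Definition lebesgueType n : measurableType _ :=
  caratheodory_type ((@borel_lebesgue R n)^*)%mu.

Definition lebesgue n : set (lebesgueType n) -> \bar R :=
  @completed_measure_extension _ _ _ (@borel_lebesgue R n).

HB.instance Definition _ n := Measure.on (@lebesgue n).

Let lebesgue_sigma_finite n : sigma_finite setT (@lebesgue n).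
Proof. exact/completed_measure_extension_sigma_finite/sigma_finiteT. Qed.

HB.instance Definition _ n :=
  @Measure_isSigmaFinite.Build _ _ _ (@lebesgue n) (@lebesgue_sigma_finite n).

Lemma borel_lebesgue_measurable n (A : set 'rV[R]_n) :
  measurable A -> measurable (A : set (lebesgueType n)).
Proof. exact: caratheodory_measurable_mu_ext. Qed.

Lemma lebesgueE n (A : set 'rV[R]_n) :
  measurable A -> lebesgue A = borel_lebesgue n A.
Proof. exact: measurable_mu_extE. Qed.

Lemma open_lebesgue_measurable n (A : set 'rV[R]_n) :
  open A -> measurable (A : set (lebesgueType n)).
Proof. by move=> /open_measurable_rV/borel_lebesgue_measurable. Qed.

Lemma compact_lebesgue_measurable n (A : set 'rV[R]_n) :
  compact A -> measurable (A : set (lebesgueType n)).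
Proof.
move=> cA; rewrite -(setCK A); apply: measurableC.
apply: open_lebesgue_measurable; rewrite openC.
by apply: compact_closed => //; exact: norm_hausdorff.
Qed.

Lemma compact_lebesgue_fin n (A : set 'rV[R]_n) : compact A -> lebesgue A < +oo.
Proof.
move=> cA; have [M AM] : exists M : R, forall x, A x -> (`|x| <= M)%R.
  have [M [_ /(_ (M + 1)%R)]] := compact_bounded cA.
  by rewrite ltrDl => /(_ ltr01) AM; exists (M + 1)%R.
pose C := [set x : 'rV[R]_n | forall i, `[(- M)%R, M]%classic (x ord0 i)].
have mC : measurable C.
  by apply: (@measurable_box _ _ (fun=> `[(- M)%R, M]%classic)).
apply: (@le_lt_trans _ _ (lebesgue C)).
  apply: le_measure; rewrite ?inE.
  - exact: compact_lebesgue_measurable.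
  - exact: borel_lebesgue_measurable.
  move=> x Ax i; rewrite /= in_itv/= -ler_norml.
  apply: le_trans (AM _ Ax); rewrite [leRHS]/Num.norm/= mx_normrE.
  by apply/bigmax_geP; right; exists (ord0, i).
rewrite lebesgueE// (borel_lebesgue_box (A := fun=> `[(- M)%R, M]%classic))//.
suff : 0 <= \prod_(i < n) @lebesgue_measure R `[(- M)%R, M]%classic < +oo.
  by case/andP.
apply: (big_ind (fun x => 0 <= x < +oo)).
- by rewrite ltry lee01.
- by move=> a b /andP[a0 aoo] /andP[b0 boo]; rewrite mule_ge0//=
    lte_mul_pinfty// ge0_fin_numE.
- move=> i _; rewrite measure_ge0/= lebesgue_measure_itv/=.
  by case: ifPn; rewrite ?ltry// -EFinB ltry.
Qed.

End lebesgue.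
(* For O open, measurability on O follows by exhausting O by compact sets. *)
Definition loc_integrable {R : realType} n (O : set 'rV[R]_n)
    (f : 'rV[R]_n -> R) :=
  forall K, K `<=` O -> compact K ->
    (@lebesgue R n).-integrable K (EFin \o f).

(* Elements are functions, not classes modulo a.e. equality on O, and their
   values outside O are irrelevant: the topology defined below is the one of
   L^1_loc(O), pulled back by the (surjective) quotient map. *)
Record L1loc {R : realType} n (O : set 'rV[R]_n) := L1Loc {
  L1loc_fun :> 'rV[R]_n -> R ;
  L1loc_fun_integrable : loc_integrable O L1loc_fun }.

Section L1loc_topology.
Context {R : realType} (n : nat) (O : set 'rV[R]_n).
Local Notation mu := (@lebesgue R n).
Local Open Scope ereal_scope.

HB.instance Definition _ := gen_eqMixin (L1loc O).
HB.instance Definition _ := gen_choiceMixin (L1loc O).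

Definition L1dist (K : set 'rV[R]_n) (f g : L1loc O) : \bar R :=
  \int[mu]_(x in K) `|f x - g x|%:E.

Lemma L1distxx K (f : L1loc O) : L1dist K f f = 0.
Proof. by apply: integral0_eq => x _; rewrite subrr normr0. Qed.

Let L1dist_measurable (f g : L1loc O) K : K `<=` O -> compact K ->
  measurable_fun (K : set (lebesgueType n))
    (fun x : lebesgueType n => `|f x - g x|%:E).
Proof.
move=> KO cK; apply/measurable_EFinP; apply: measurableT_comp => //.
apply: measurable_funB; apply/measurable_EFinP.
  exact: measurable_int (L1loc_fun_integrable f KO cK).
exact: measurable_int (L1loc_fun_integrable g KO cK).
Qed.

Lemma L1dist_subset K L (f g : L1loc O) : compact K -> compact L ->
  K `<=` O -> L `<=` K -> L1dist L f g <= L1dist K f g.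
Proof.
move=> cK cL KO LK; apply: ge0_subset_integral => //.
- exact: compact_lebesgue_measurable.
- exact: compact_lebesgue_measurable.
- exact: L1dist_measurable.
Qed.

Lemma L1dist_triangle K (f g h : L1loc O) : K `<=` O -> compact K ->
  L1dist K f h <= L1dist K f g + L1dist K g h.
Proof.
move=> KO cK; have mK := compact_lebesgue_measurable cK.
have mB u v := L1dist_measurable u v KO cK.
rewrite /L1dist -ge0_integralD//.
apply: ge0_le_integral => //.
- exact: emeasurable_funD.
- by move=> x _; rewrite -EFinD lee_fin; exact: ler_distD.
Qed.

Definition L1loc_nbhs (f : L1loc O) : set_system (L1loc O) :=
  [set A | exists K (e : R), [/\ K `<=` O, compact K, (0 < e)%R &
    [set g | L1dist K f g < e%:E] `<=` A]].

HB.instance Definition _ := hasNbhs.Build (L1loc O) L1loc_nbhs.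

Let L1loc_nbhs_filter (f : L1loc O) : ProperFilter (nbhs f).
Proof.
apply: Build_ProperFilter_ex => [A [K [e [_ _ e0 KA]]]|].
  by exists f; apply: KA; rewrite /= L1distxx lte_fin.
split.
- by exists set0, 1%R; split => //; exact: compact0.
- move=> A B [K [e [KO cK e0 KA]]] [L [d [LO cL d0 LB]]].
  exists (K `|` L), (Num.min e d); split.
  + by move=> x [/KO|/LO].
  + exact: compactU.
  + by rewrite lt_min e0 d0.
  move=> g /= fg; split; [apply: KA|apply: LB] => /=.
    apply: (@le_lt_trans _ _ (L1dist (K `|` L) f g)).
      apply: L1dist_subset; [exact: compactU|by []|by move=> x [/KO|/LO]|].
      exact: subsetUl.
    by rewrite (lt_le_trans fg)// lee_fin ge_min lexx.
  apply: (@le_lt_trans _ _ (L1dist (K `|` L) f g)).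
    apply: L1dist_subset; [exact: compactU|by []|by move=> x [/KO|/LO]|].
    exact: subsetUr.
  by rewrite (lt_le_trans fg)// lee_fin ge_min lexx orbT.
- move=> A B AB [K [e [KO cK e0 KA]]]; exists K, e; split => //.
  exact: subset_trans AB.
Qed.

Let L1loc_nbhs_singleton (f : L1loc O) (A : set (L1loc O)) : nbhs f A -> A f.
Proof.
by move=> [K [e [_ _ e0 KA]]]; apply: KA; rewrite /= L1distxx lte_fin.
Qed.

Let L1loc_nbhs_nbhs (f : L1loc O) (A : set (L1loc O)) :
  nbhs f A -> nbhs f (nbhs^~ A).
Proof.
move=> [K [e [KO cK e0 KA]]]; exists K, (e / 2)%R; split => //.
  by rewrite divr_gt0.
move=> g /= fg; exists K, (e / 2)%R; split => //; first by rewrite divr_gt0.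
move=> h /= gh; apply: KA => /=.
rewrite (le_lt_trans (L1dist_triangle _ g _ KO cK))//.
by rewrite (splitr e) EFinD lteD.
Qed.

HB.instance Definition _ := Nbhs_isNbhsTopological.Build (L1loc O)
  L1loc_nbhs_filter L1loc_nbhs_singleton L1loc_nbhs_nbhs.

End L1loc_topology.
Section partitions.
Context {R : realType}.
Local Open Scope ereal_scope.

Record is_mpartition n m (O : set 'rV[R]_n) (E : 'I_m -> set 'rV[R]_n) : Prop :=
  IsMPartition {
    partition_measurable : forall i, measurable (E i : set (lebesgueType n)) ;
    partition_sub : forall i, E i `<=` O ;
    partition_disj : forall i j, i != j -> lebesgue (E i `&` E j) = 0 ;
    partition_cover : lebesgue (O `\` \bigcup_(i in [set: 'I_m]) E i) = 0 }.

Record mpartition n m (O : set 'rV[R]_n) := MPartition {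
  chamber :> 'I_m -> set 'rV[R]_n ;
  chamberP : is_mpartition O chamber }.

Section chi.
Context n (O A : set 'rV[R]_n) (mA : measurable (A : set (lebesgueType n))).

Let chi_integrable : loc_integrable O (\1_A : 'rV[R]_n -> R).
Proof.
move=> K KO cK; have mK := compact_lebesgue_measurable cK.
apply/integrableP; split.
  apply/measurable_EFinP.
  exact: (measurable_indic (T := lebesgueType n)).
apply: (@le_lt_trans _ _ (\int[@lebesgue R n]_(x in K) 1)).
  apply: ge0_le_integral => //.
  - apply: measurableT_comp => //; apply/measurable_EFinP.
    exact: (measurable_indic (T := lebesgueType n)).
  - by move=> x _; rewrite /= lee_fin indicE ger0_norm// lern1; case: (_ \in _).
by rewrite integral_cst// mul1e; exact: compact_lebesgue_fin.
Qed.

Definition chi : L1loc O := L1Loc chi_integrable.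

End chi.

Definition chi_partition n m (P O : set 'rV[R]_n) (E : mpartition m P) :
    {ptws 'I_m -> L1loc O} :=
  fun i => chi O (partition_measurable (chamberP E) i).

(* The library norm on 'rV[R]_n is the sup norm, equivalent to this one. *)
Definition enorm n (x : 'rV[R]_n) : R :=
  Num.sqrt (\sum_(i < n) x ord0 i ^+ 2)%R.

(* On the (null) diagonal the integrand takes the junk value 0. *)
Definition interaction n (s : R) (A B : set 'rV[R]_n) : \bar R :=
  \int[@lebesgue R n \x @lebesgue R n]_(z in A `*` B)
    ((enorm (z.1 - z.2) `^ (n%:R + 2 * s))^-1)%:E.

(* Since 0 * +oo = 0 in \bar R, the diagonal terms of the sums below vanish. *)
Section energies.
Context n m (sigma : 'M[R]_m) (s : R) (E : 'I_m -> set 'rV[R]_n).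
Variable O : set 'rV[R]_n.

Definition inner_energy : \bar R :=
  2^-1%:E * \sum_(i < m) \sum_(j < m)
    (sigma i j)%:E * interaction s (E i `&` O) (E j `&` O).

Definition outer_energy : \bar R :=
  2^-1%:E * \sum_(i < m) \sum_(j < m)
    (sigma i j)%:E * (interaction s (E i `&` O) (E j `&` ~` O) +
                      interaction s (E i `&` ~` O) (E j `&` O)).

Definition fractional_perimeter : \bar R := inner_energy + outer_energy.

End energies.

Definition admissible_partitions n m (sigma : 'M[R]_m) (s : R)
    (O : set 'rV[R]_n) : set (mpartition m [set: 'rV[R]_n]) :=
  [set E | fractional_perimeter sigma s E O < +oo].

Definition surface_tensions m : set 'M[R]_m :=
  [set sigma | [/\ sigma^T = sigma, forall i, sigma i i = 0%R &
    forall i j, i != j -> (0 < sigma i j)%R]].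

Definition compactly_included n (A B : set 'rV[R]_n) :=
  compact (closure A) /\ closure A `<=` B.

Section perimeter.
Context (n : nat).
Local Notation basis i := (delta_mx ord0 i : 'rV[R]_n).

Definition C1 (phi : 'rV[R]_n -> 'rV[R]_n) :=
  forall i, (forall x, derivable phi x (basis i)) /\
            continuous (fun x => 'D_(basis i) phi x).

Definition divergence (phi : 'rV[R]_n -> 'rV[R]_n) (x : 'rV[R]_n) : R :=
  (\sum_(i < n) ('D_(basis i) phi x) ord0 i)%R.

Definition test_fields (O : set 'rV[R]_n) : set ('rV[R]_n -> 'rV[R]_n) :=
  [set phi | [/\ C1 phi,
    exists2 K, compact K /\ K `<=` O & forall x, ~ K x -> phi x = 0%R &
    forall x, (enorm (phi x) <= 1)%R]].

Definition perimeter (E O : set 'rV[R]_n) : \bar R :=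
  ereal_sup [set \int[@lebesgue R n]_(x in E `&` O) (divergence phi x)%:E
            | phi in test_fields O].

Definition caccioppoli_partition m (O : set 'rV[R]_n)
    (E : 'I_m -> set 'rV[R]_n) :=
  is_mpartition O E /\ forall i, perimeter (E i) O < +oo.

End perimeter.

(* Near each boundary point, in suitable Cartesian coordinates y *m Q, the set
   is the strict epigraph of a Lipschitz function in the direction i. *)
Definition lipschitz_boundary n (O : set 'rV[R]_n) :=
  forall x, (closure O `\` interior O) x ->
  exists (r : R) (Q : 'M[R]_n) (i : 'I_n) (g : 'rV[R]_n.-1 -> R),
    [/\ (0 < r)%R, Q *m Q^T = 1%:M, lipschitz g &
     forall y, (enorm (y - x) < r)%R ->
       (O y <-> (g (col' i (y *m Q)) < (y *m Q) ord0 i)%R)].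

End partitions.

(* Main.v *)
Require Import Defs.
From mathcomp Require Import all_boot all_order all_algebra.
From mathcomp Require Import all_classical all_reals all_analysis.
From mathcomp Require Import measurable_realfun.
From mathcomp Require Import ring lra.
Import Order.TTheory GRing.Theory Num.Theory.
Import numFieldNormedType.Exports.

(** Everything is read off the jump volumes |A `&` (E `+` (E - h))|, the measure
    of the points x of A such that exactly one of x, x + h lies in E
    ([jumpvol]).

    - Energy controls jumps. If exactly one of x, x + z lies in the i-th chamber,
      then x and x + z lie in two distinct chambers, one of them the i-th.
      Since the tensions are bounded below off the diagonal, the energy in O
      bounds the integral over |z| < r of |z|^-(n+2s) times the jump volume by
      z, on any set G with G + B_r inside O ([inner_energy_jump]).

    - The factor 1 - 2s is absorbed by scaling. A jump across z forces a jump
      across one of the 2^j consecutive segments z / 2^j, so the jump volume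
      by z is at most 2^j times the one by z / 2^j ([jumpvol_chain]). The
      dyadic scale r / 2^j of the kernel therefore contributes at least
      2^(-j(1-2s)) times what the scale r does, and these factors sum up to
      about 1 / (1 - 2s). A bound on (1 - 2s) times the energy thus gives
      jump volumes integrating to at most M r^(n+2s) over B_r and, after
      averaging h = (h + z) - z over z in B_r, bounded by M r^(2s) for
      |h| < r; M does not depend on the partition ([uniform_jump_bounds]).

    - Compactness. Let C, D have the same majority in every ball of radius rho
      of a finite net of K. At a point where C and D differ, one of them
      disagrees with its own majority nearby, so K `&` (C `+` D) is small if
      the jumps of C and D at scale 2 rho are ([majority_vote]). There are
      finitely many majority patterns, which makes the chambers totally bounded
      on every compact set. Indicators being closed under local L1 convergence,
      each chamber ranges in a compact set, and Tychonoff's theorem concludes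
      ([precompact_chambers]).

    - Limits. A cluster point is approached along indices k_j at rate 2^-j on an
      exhaustion of Omega by compact sets; by Borel-Cantelli the chambers
      converge pointwise almost everywhere, so the limit sets form a partition.
      As 2 s_k tends to 1, their jump volumes satisfy the bound L |h|
      ([limit_jump_bound]). Tested against a C1 field with values in the unit
      ball, the difference quotients of the indicator are then bounded by L in each
      direction, and passing to the limit bounds the perimeter by n L
      ([perimeter_of_jump_bound]). *)

Set Implicit Arguments.
Unset Strict Implicit.
Unset Printing Implicit Defensive.

Local Open Scope classical_set_scope.
Local Open Scope ring_scope.

(** * The Lebesgue measure under affine maps *)

Section borel_change_of_variables.
Context {R : realType}.

(** By uniqueness of the Lebesgue measure: the pushforward of lebesgue_measure,
    multiplied by [a], has the right value on the half-open intervals. *)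
Lemma lebesgue_measure_affine (a b : R) (A : set R) : 0 < a -> measurable A ->
  lebesgue_measure ((fun x => a * x + b) @^-1` A) =
  ((a^-1)%:E * lebesgue_measure A)%E.
Proof.
move=> a0 mA.
have maff : measurable_fun [set: measurableTypeR R]
    ((fun x => a * x + b) : measurableTypeR R -> measurableTypeR R).
  by apply: measurable_funD => //; apply: measurable_funM.
pose phi : measurableTypeR R -> measurableTypeR R := fun x => a * x + b.
pose m1 : {measure set (measurableTypeR R) -> \bar R} :=
  pushforward lebesgue_measure phi.
pose m2 : {measure set (measurableTypeR R) -> \bar R} :=
  mscale (NngNum (ltW a0)) (m1 maff).
have H X : ocitv X -> lebesgue_measure X = m2 X.
  move=> [[x y]] _ <-.
  rewrite -[RHS]/(a%:E * lebesgue_measure (phi @^-1` `]x, y]%classic))%E.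
  have -> : phi @^-1` `]x, y]%classic = `](x - b) / a, (y - b) / a]%classic.
    apply/seteqP; split=> z; rewrite /phi/= !in_itv/=
      ltr_pdivrMr// ler_pdivlMr// ltrBlDr lerBrDr (mulrC a) //.
  rewrite !lebesgue_measure_itv/= !lte_fin ltr_pM2r ?invr_gt0// ltrD2r.
  case: ifPn => _; last by rewrite mule0.
  rewrite -!EFinB -EFinM; congr EFin.
  by rewrite -mulrBl mulrC mulrVK ?unitfE ?gt_eqF//; ring.
rewrite (lebesgue_measure_unique H mA).
rewrite -[X in (_ * X)%E]/(a%:E * lebesgue_measure (phi @^-1` A))%E muleA -EFinM mulVf ?gt_eqF//.
by rewrite mul1e.
Qed.

(** The boxes form a generating pi-system, the form in which the uniqueness of
    measures can be applied to [borel_lebesgue]. *)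
Lemma borel_rV_boxes n : @measurable _ 'rV[R]_n =
  <<s [set [set x : 'rV[R]_n | forall i, A i (x ord0 i)] |
       A in [set A : 'I_n -> set R | forall i, measurable (A i)]] >>.
Proof.
apply/seteqP; split; last first.
  apply: smallest_sub; first exact: sigma_algebra_measurable.
  by move=> _ [A mA <-]; exact: measurable_box.
apply: smallest_sub; first exact: smallest_sigma_algebra.
apply: (big_ind (fun X => X `<=` _)) => //.
- by move=> A B sA sB x [/sA|/sB].
- move=> i _ _ [B mB <-]; apply: sub_sigma_algebra.
  exists (fun j => if j == i then B else setT).
    by move=> j; case: ifP.
  apply/seteqP; split => x /=.
    by move=> /(_ i); rewrite eqxx; split.
  by move=> [_ Bx] j; case: eqP => [->|].
Qed.

Lemma measurable_affine n (a : R) (h : 'rV[R]_n) :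
  measurable_fun [set: 'rV[R]_n] (fun x => a *: x + h).
Proof.
apply: measurable_rV => i; under eq_fun do rewrite !mxE.
apply: measurable_funD => //; apply: measurable_funM => //.
exact: measurable_coord.
Qed.

(** On boxes this is the one-dimensional statement in each coordinate; boxes
    determine the measure. *)
Lemma borel_lebesgue_affine n (a : R) (h : 'rV[R]_n) (A : set 'rV[R]_n) :
  0 < a -> measurable A ->
  borel_lebesgue n ((fun x => a *: x + h) @^-1` A) =
  (((a ^+ n)^-1)%:E * borel_lebesgue n A)%E.
Proof.
move=> a0 mA.
have maff := measurable_affine a h.
pose phi : 'rV[R]_n -> 'rV[R]_n := fun x => a *: x + h.
pose m1 : {measure set 'rV[R]_n -> \bar R} := pushforward (borel_lebesgue n) phi.
have an0 : 0 <= a ^+ n by rewrite exprn_ge0// ltW.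
pose m2 : {measure set 'rV[R]_n -> \bar R} := mscale (NngNum an0) (m1 maff).
have E B : measurable B -> borel_lebesgue n B = m2 B.
  move=> mB.
  apply: (measure_unique _
    (fun k => [set x : 'rV[R]_n | forall i, `](- k%:R), k%:R[%classic (x ord0 i)])
    (borel_rV_boxes n)) => //.
  - move=> _ _ [U mU <-] [V mV <-]; exists (fun i => U i `&` V i).
      by move=> i; exact: measurableI.
    by apply/seteqP; split=> x /= => [UV|[Ux Vx] i]; split => // i; have [] := UV i.
  - by move=> k; exists (fun=> `](- k%:R), k%:R[%classic) => // i; exact: measurable_itv.
  - rewrite -subTset => x _.
    have [k xk] : exists k : nat, `|x| < k%:R.
      by exists (Num.trunc `|x|).+1; rewrite truncnS_gt.
    exists k => // i /=; rewrite in_itv/= -ltr_norml.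
    apply: le_lt_trans xk; rewrite [leRHS]/Num.norm/= mx_normrE.
    by apply/bigmax_geP; right; exists (ord0, i).
  - move=> _ [U mU <-]; pose bU := [set x : 'rV[R]_n | forall i, U i (x ord0 i)].
    rewrite -[RHS]/((a ^+ n)%:E * borel_lebesgue n (phi @^-1` bU))%E.
    have -> : phi @^-1` bU =
        [set x | forall i, ((fun t => a * t + h ord0 i) @^-1` U i) (x ord0 i)].
      by apply/seteqP; split=> x /= Ux i; have := Ux i; rewrite /phi !mxE.
    have mpU i : measurable ((fun t => a * t + h ord0 i) @^-1` U i).
      have mUi : measurable (U i) by exact: mU.
      rewrite -[X in measurable X]setTI.
      suff : measurable_fun [set: measurableTypeR R]
        ((fun t => a * t + h ord0 i) : measurableTypeR R -> measurableTypeR R) by apply.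
      by apply: measurable_funD => //; apply: measurable_funM.
    apply: etrans (borel_lebesgue_box mU) _.
    apply: etrans (congr1 (mule _) (esym (borel_lebesgue_box mpU))).
    under [in RHS]eq_bigr do rewrite lebesgue_measure_affine//.
    rewrite big_split/= prodEFin prodr_const card_ord muleA -EFinM -exprMn.
    by rewrite mulfV ?gt_eqF// expr1n mul1e.
  - move=> k.
    rewrite [X in (X < _)%E](_ : _ =
      \prod_(i < n) lebesgue_measure (`](- k%:R), k%:R[%classic : set R)%R)%E; last first.
      exact: (borel_lebesgue_box (fun=> measurable_itv _)).
    under eq_bigr do rewrite lebesgue_measure_itv/=.
    have [kk|] := ltP (- k%:R : R)%:E k%:R%:E.
      by under eq_bigr do rewrite -EFinB; rewrite prodEFin ltry.
    case: (n) => [|n' _]; first by rewrite big_ord0 ltry.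
    by rewrite big_ord_recl mul0e.
rewrite (E _ mA).
rewrite -[X in (_ * X)%E]/((a ^+ n)%:E * borel_lebesgue n (phi @^-1` A))%E muleA -EFinM mulVf ?mul1e//.
by rewrite expf_neq0// gt_eqF.
Qed.

Lemma borel_lebesgue_translate n (h : 'rV[R]_n) (A : set 'rV[R]_n) :
  measurable A -> borel_lebesgue n [set x | A (x + h)] = borel_lebesgue n A.
Proof.
move=> mA; have := borel_lebesgue_affine h ltr01 mA.
rewrite expr1n invr1 mul1e => <-.
by congr (_ _); apply/seteqP; split=> x /=; rewrite scale1r.
Qed.

Lemma ge0_integral_affine n (a : R) (h : 'rV[R]_n) (f : 'rV[R]_n -> \bar R) :
  0 < a -> measurable_fun setT f -> (forall x, (0 <= f x)%E) ->
  (\int[borel_lebesgue n]_x f (a *: x + h)%R =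
   ((a ^+ n)^-1)%:E * \int[borel_lebesgue n]_x f x)%E.
Proof.
move=> a0 mf f0.
have an0 : 0 <= (a ^+ n)^-1 by rewrite invr_ge0 exprn_ge0// ltW.
have := @ge0_integral_pushforward _ _ _ _ _ _ (measurable_affine a h)
  (borel_lebesgue n) setT f measurableT mf (fun x _ => f0 x).
rewrite preimage_setT => <-.
rewrite -(@ge0_integral_mscale _ _ _ _ _ measurableT (NngNum an0))//.
apply: eq_measure_integral; first exact: measurable_affine.
by move=> mphi A mA _; exact: (borel_lebesgue_affine h a0 mA).
Qed.

Lemma ge0_integral_translate n (h : 'rV[R]_n) (f : 'rV[R]_n -> \bar R) :
  measurable_fun setT f -> (forall x, (0 <= f x)%E) ->
  (\int[borel_lebesgue n]_x f (x + h)%R = \int[borel_lebesgue n]_x f x)%E.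
Proof.
move=> mf f0; have := ge0_integral_affine h ltr01 mf f0.
rewrite expr1n invr1 mul1e => <-.
by apply: eq_integral => x _; rewrite scale1r.
Qed.

Lemma measurable_ball_rV n (x : 'rV[R]_n) r : measurable (ball x r).
Proof.
apply: open_measurable_rV.
exact: ball_open.
Qed.

Lemma rV_norm_lt n (x : 'rV[R]_n) r : 0 < r ->
  (`|x| < r) <-> (forall i, `|x ord0 i| < r).
Proof.
move=> r0; rewrite [in `|x|]/Num.norm/= mx_normrE; split.
  by move=> /bigmax_ltP[_ /= xr] i; exact: (xr (ord0, i)).
by move=> xr; apply/bigmax_ltP; split => // -[j i] _ /=; rewrite ord1.
Qed.

Lemma ball0P n r (x : 'rV[R]_n) : ball (0 : 'rV[R]_n) r x <-> `|x| < r.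
Proof. by rewrite mx_norm_ball /ball_/= sub0r normrN. Qed.

Lemma borel_lebesgue_ball n (x : 'rV[R]_n) r : 0 < r ->
  borel_lebesgue n (ball x r) = ((2 * r) ^+ n)%:E.
Proof.
move=> r0.
have -> : ball x r = [set y : 'rV[R]_n | forall i,
    `](x ord0 i - r), (x ord0 i + r)[%classic (y ord0 i)].
  rewrite mx_norm_ball /ball_; apply/seteqP; split=> y /=.
   by move=> /rV_norm_lt yr i; have := yr r0 i;
      rewrite !mxE in_itv/= -ltr_distl distrC.
  by move=> yr; apply/rV_norm_lt => // i; have := yr i;
      rewrite !mxE in_itv/= -ltr_distl distrC.
rewrite (borel_lebesgue_box
  (A := fun i => `](x ord0 i - r), (x ord0 i + r)[%classic))//.
under eq_bigr.
  move=> i _; rewrite lebesgue_measure_itv/= lte_fin ltrD2l gtrN// -EFinB.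
  rewrite (_ : _ - _ = 2 * r); last by ring.
  over.
by rewrite prodEFin prodr_const card_ord.
Qed.

End borel_change_of_variables.

(** * The volume of the jumps of a set under a translation *)

Section jumps.
Context {R : realType} {n : nat}.
Local Notation mu := (@borel_lebesgue R n).
Implicit Types (A E G P Q : set 'rV[R]_n) (h z : 'rV[R]_n).

Lemma setY_iff T (A B : set T) x : (A `+` B) x <-> ~ (A x <-> B x).
Proof. by rewrite /setY/=; case: (pselect (A x)); case: (pselect (B x)); tauto. Qed.

Lemma measurableY d (T : ringOfSetsType d) (A B : set T) :
  measurable A -> measurable B -> measurable (A `+` B).
Proof. by move=> mA mB; apply: measurableU; exact: measurableD. Qed.

Definition translate h E := [set x | E (x + h)].

Lemma measurable_translate h E : measurable E -> measurable (translate h E).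
Proof.
move=> mE; rewrite -[X in measurable X]setTI.
have := measurable_affine 1 h measurableT mE.
by congr (measurable (_ `&` _)); apply/seteqP; split => x /=; rewrite scale1r.
Qed.

Definition jumpvol A E h : \bar R := mu (A `&` (E `+` translate h E)).

Lemma measurable_jump E h : measurable E -> measurable (E `+` translate h E).
Proof. by move=> mE; apply: measurableY => //; exact: measurable_translate. Qed.

Lemma jumpvolS A G E h : measurable A -> measurable G -> measurable E ->
  A `<=` G -> (jumpvol A E h <= jumpvol G E h)%E.
Proof.
move=> mA mG mE AG; apply: le_measure; rewrite ?inE;
  [by apply: measurableI => //; exact: measurable_jump..|].
exact: setSI.
Qed.

(** If E changes between x and x + h, it changes across one of the N segments of
    length |h| / N joining them; the segment starts inside G, and translations
    preserve the measure. *)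
Lemma jumpvol_chain (N : nat) A G E h : (0 < N)%N ->
  measurable A -> measurable G -> measurable E ->
  (forall x (t : R), 0 <= t <= 1 -> A x -> G (x + t *: h)) ->
  (jumpvol A E h <= N%:R%:E * jumpvol G E (N%:R^-1 *: h))%E.
Proof.
move=> N0 mA mG mE AG.
have NR0 : (N%:R : R) != 0 by rewrite pnatr_eq0 -lt0n.
pose k := N%:R^-1 *: h.
pose T (i : nat) := translate (i%:R *: k) (G `&` (E `+` translate k E)).
have mGk : measurable (G `&` (E `+` translate k E)).
  by apply: measurableI => //; exact: measurable_jump.
have mT i : measurable (T i) by exact: measurable_translate.
have AT : A `&` (E `+` translate h E) `<=` \big[setU/set0]_(i < N) T i.
  move=> x [Ax /setY_iff ExE]; apply: contrapT => nT; apply: ExE.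
  have step (i : nat) : (i < N)%N ->
      E (x + i%:R *: k) <-> E (x + i.+1%:R *: k).
    move=> iN; apply: contrapT => nE; apply: nT.
    rewrite -bigcup_mkord; exists i => //; split.
      rewrite scalerA; apply: AG => //.
      by rewrite divr_ge0//= ler_pdivrMr ?mul1r ?ler_nat 1?ltnW// ltr0n.
    apply/setY_iff; move: nE.
    have e : i.+1%:R *: k = i%:R *: k + k by rewrite -natr1 scalerDl scale1r.
    by rewrite /translate/= -addrA -e.
  have H (i : nat) : (i <= N)%N -> E x <-> E (x + i%:R *: k).
    elim: i => [|i IH] iN; first by rewrite scale0r addr0.
    by rewrite (IH (ltnW iN)) step.
  by rewrite (H N (leqnn N)) scalerA mulfV// scale1r.
apply: (@le_trans _ _ (mu (\big[setU/set0]_(i < N) T i))).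
  apply: le_measure; rewrite ?inE => //.
    by apply: measurableI => //; exact: measurable_jump.
  exact: bigsetU_measurable.
apply: (@le_trans _ _ (\sum_(i < N) mu (T i))%E); first exact: Boole_inequality.
under eq_bigr do rewrite borel_lebesgue_translate//.
by rewrite sumr_const card_ord mule_natl.
Qed.

(** Subadditivity of the jumps: x + (h + k) is an intermediate stop between x
    and x + h. Bounding the jump by a fixed h in terms of those by k and h + k, it
    can be averaged in k. *)
Lemma jumpvolD A G E h k : measurable A -> measurable G -> measurable E ->
  A `<=` G -> A `<=` translate h G ->
  (jumpvol A E h <= jumpvol G E k + jumpvol G E (h + k))%E.
Proof.
move=> mA mG mE AG AhG.
have mGk l : measurable (G `&` (E `+` translate l E)).
  by apply: measurableI => //; exact: measurable_jump.
rewrite /jumpvol -[X in (_ <= X + _)%E](borel_lebesgue_translate h)//.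
have mT := measurable_translate h (mGk k).
apply: le_trans (measureU2 _ mT (mGk _)).
apply: le_measure; rewrite ?inE.
- by apply: measurableI => //; exact: measurable_jump.
- exact: measurableU.
move=> x [Ax /setY_iff nE]; apply: contrapT => H; apply: nE.
have H1 : E (x + h) <-> E (x + h + k).
  by apply: contrapT => nE; apply: H; left; split; [exact: AhG|exact/setY_iff].
have H2 : E x <-> E (x + (h + k)).
  by apply: contrapT => nE; apply: H; right; split; [exact: AG|exact/setY_iff].
by rewrite H2 /translate/= H1 addrA.
Qed.

Lemma measurable_rV_add : measurable_fun [set: 'rV[R]_n * 'rV[R]_n]
  (fun p => p.1 + p.2).
Proof.
apply: measurable_rV => i; under eq_fun do rewrite mxE.
apply: measurable_funD.
- exact: (measurableT_comp (measurable_coord i) measurable_fst).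
- exact: (measurableT_comp (measurable_coord i) measurable_snd).
Qed.

Lemma measurable_cross P Q : measurable P -> measurable Q ->
  measurable_fun setT (fun z => mu (P `&` translate z Q)).
Proof.
move=> mP mQ.
have mS : measurable ((snd @^-1` P) `&` ((fun p => p.1 + p.2) @^-1` Q)
    : set ('rV[R]_n * 'rV[R]_n)).
  apply: measurableI; rewrite -[X in measurable X]setTI.
  - exact: measurable_snd.
  - exact: measurable_rV_add.
have := measurable_fun_xsection mu mS.
congr measurable_fun; apply/funext => z /=; congr (_ _).
apply/seteqP; split => x; rewrite xsectionE /translate/= (addrC z);
  by move=> /=; rewrite ?inE.
Qed.

Lemma jumpvolE A E h : measurable A -> measurable E ->
  jumpvol A E h =
  (mu (A `&` E `&` translate h (~` E)) + mu ((A `\` E) `&` translate h E))%E.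
Proof.
move=> mA mE; rewrite /jumpvol -measureU.
- congr (_ _); apply/seteqP; split => x /=; rewrite /setY/translate/=.
    by move=> [Ax [[]|[]]]; [left|right].
  by move=> [[[Ax ?] ?]|[[? ?] ?]]; split => //; [left|right].
- apply: measurableI; [exact: measurableI|apply: measurable_translate; exact: measurableC].
- by apply: measurableI; [exact: measurableD|exact: measurable_translate].
- by rewrite -subset0 => x [[[_ Ex] _] [[_ nEx] _]].
Qed.

Lemma measurable_jumpvol A E : measurable A -> measurable E ->
  measurable_fun setT (jumpvol A E).
Proof.
move=> mA mE.
rewrite (_ : jumpvol A E = fun h => (mu (A `&` E `&` translate h (~` E)) +
   mu ((A `\` E) `&` translate h E))%E); last first.
  by apply/funext => h; exact: jumpvolE.
apply: emeasurable_funD; apply: measurable_cross => //.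
- exact: measurableI.
- exact: measurableC.
- exact: measurableD.
Qed.

(** The change of variables y = x + z turns the double integral over P * Q into
    an integral over the displacement z. *)
Lemma interaction_cross (k : 'rV[R]_n -> \bar R) P Q :
  measurable_fun setT k -> (forall z, 0 <= k z)%E ->
  measurable P -> measurable Q ->
  (\int[mu]_(x in P) \int[mu]_(y in Q) k (y - x)%R =
   \int[mu]_z (k z * mu (P `&` translate z Q)))%E.
Proof.
move=> mk k0 mP mQ.
pose f (p : 'rV[R]_n * 'rV[R]_n) : \bar R :=
  (k p.2 * (\1_(P `&` translate p.2 Q) p.1)%:E)%E.
have fE p : f p = (k p.2 * (\1_P p.1)%:E * (\1_Q (p.1 + p.2)%R)%:E)%E.
  rewrite /f -muleA -EFinM; congr (_ * _%:E)%E.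
  by rewrite !indicE in_setI -mulnb natrM.
have f0 p : (0 <= f p)%E by rewrite mule_ge0// lee_fin.
have mf : measurable_fun setT f.
  rewrite (_ : f = fun p => (k p.2 * (\1_P p.1)%:E * (\1_Q (p.1 + p.2)%R)%:E)%E);
    last by apply/funext => p; exact: fE.
  have mi S : measurable S -> measurable_fun setT (\1_S : 'rV[R]_n -> R).
    exact: measurable_indic.
  apply: emeasurable_funM; [apply: emeasurable_funM|].
  - exact: (measurableT_comp mk measurable_snd).
  - apply/measurable_EFinP.
    exact: (measurableT_comp (mi _ mP) measurable_fst).
  - apply/measurable_EFinP.
    exact: (measurableT_comp (mi _ mQ) measurable_rV_add).
transitivity (\int[mu]_x \int[mu]_z f (x, z))%E.
  rewrite integral_mkcond; apply: eq_integral => x _.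
  rewrite epatch_indic /=.
  pose g y : \bar R := (k (y - x)%R * (\1_Q y)%:E)%E.
  have mg : measurable_fun setT g.
    apply: emeasurable_funM; last exact/measurable_EFinP/measurable_indic.
    apply: (measurableT_comp mk).
    have := measurable_affine 1 (- x); congr measurable_fun.
    by apply/funext => z; rewrite scale1r.
  have g0 y : (0 <= g y)%E by rewrite mule_ge0// lee_fin.
  rewrite integral_mkcond epatch_indic -[X in (X * _)%E]/(\int[mu]_y g y)%E.
  rewrite -(ge0_integral_translate x mg g0) -ge0_integralZr//; last first.
    apply: (measurableT_comp mg).
    have := measurable_affine 1 x; congr measurable_fun.
    by apply/funext => z; rewrite scale1r.
  apply: eq_integral => z _; rewrite fE /g/= addrK (addrC z).
  by rewrite -muleA (muleC (_%:E)) muleA.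
rewrite (fubini_tonelli f mf f0); apply: eq_integral => z _.
rewrite /f/= ge0_integralZl//.
- rewrite integral_indic// ?setIT//.
  by apply: measurableI => //; exact: measurable_translate.
- apply/measurable_EFinP/measurable_indic; apply: measurableI => //.
  exact: measurable_translate.
Qed.

End jumps.

(** * Lebesgue measurable sets through their Borel hulls *)

Section completion.
Context {R : realType} {n : nat}.
Local Notation mu := (@borel_lebesgue R n).
Local Notation leb := (@lebesgue R n).
Local Notation mleb A := (measurable (A : set (lebesgueType n))).
Implicit Types A B C E : set 'rV[R]_n.

(** The completed measure is an outer measure, computed by countable covers by
    Borel sets. *)
Lemma lebesgue_outer_cover A (e : R) : mleb A -> (leb A < +oo)%E -> 0 < e ->
  exists B, [/\ measurable B, A `<=` B & (leb (B `\` A) <= e%:E)%E].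
Proof.
move=> mA Aoo e0.
have Afin : ereal_inf [set (\sum_(k <oo) mu (F k))%E | F in measurable_cover A]
    \is a fin_num.
  by rewrite ge0_fin_numE//; exact: (measure_ge0 leb A).
have [_ [F [mF AF] <-] Fe] := lb_ereal_inf_adherent e0 Afin.
have mUF : measurable (\bigcup_k F k) by exact: bigcupT_measurable.
have mlUF := borel_lebesgue_measurable mUF.
have UFe : (leb (\bigcup_k F k) <= leb A + e%:E)%E.
  rewrite lebesgueE//; apply: le_trans (ltW Fe).
  exact: measure_sigma_subadditive.
exists (\bigcup_k F k); split => //.
rewrite measureD//; last by rewrite (le_lt_trans UFe)// lte_add_pinfty ?ltry.
rewrite setIidr// leeBlDr ?ge0_fin_numE//.
by rewrite addeC.
Qed.

(** The chambers are only Lebesgue measurable, but translations, products and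
    Fubini are handled with the Borel sigma-algebra of R^n; replacing a chamber
    by such a set B changes neither measures nor energies. *)
Lemma lebesgue_borel_hull A : mleb A ->
  exists2 B, measurable B & {ae leb, forall x, A x <-> B x}.
Proof.
have hull_fin X : mleb X -> (leb X < +oo)%E ->
    exists B, [/\ measurable B, X `<=` B & leb (B `\` X) = 0%E].
  move=> mX Xoo.
  have /choice[F HF] (k : nat) : exists B, [/\ measurable B, X `<=` B &
      (leb (B `\` X) <= (k.+1%:R^-1)%:E)%E].
    by apply: lebesgue_outer_cover; rewrite // invr_gt0.
  have mF k : measurable (F k) by have [] := HF k.
  have mIF : measurable (\bigcap_k F k) by exact: bigcapT_measurable.
  exists (\bigcap_k F k); split => //.
    by move=> x Xx k _; have [_ + _] := HF k; exact.
  apply/eqP; rewrite eq_le measure_ge0 andbT.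
  apply/lee_addgt0Pr => e e0; rewrite add0e.
  have [k _ /(_ k (leqnn k)) /= ke] := near_infty_natSinv_lt (PosNum e0).
  have [_ _ Fk] := HF k.
  apply: le_trans (le_trans Fk _); last by rewrite lee_fin ltW.
  apply: le_measure; rewrite ?inE.
  - by apply: measurableD => //; exact: borel_lebesgue_measurable.
  - by apply: measurableD => //; exact: borel_lebesgue_measurable.
  - by apply: setSD => x /(_ k I).
move=> mA.
have /sigma_finiteP[S [ST _ HS]] := sigma_finiteT (@borel_lebesgue R n).
have mS k : mleb (S k) by apply: borel_lebesgue_measurable; have [] := HS k.
have /choice[F HF] (k : nat) : exists B, [/\ measurable B, A `&` S k `<=` B &
    leb (B `\` (A `&` S k)) = 0%E].
  apply: hull_fin; first exact: measurableI.
  have [mSk Sk] := HS k.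
  apply: (@le_lt_trans _ _ (leb (S k))); last by rewrite lebesgueE.
  by apply: le_measure; rewrite ?inE//; exact: measurableI.
have mF k : measurable (F k) by have [] := HF k.
exists (\bigcup_k F k); first exact: bigcupT_measurable.
have : leb.-negligible (\bigcup_k (F k `\` (A `&` S k))).
  apply: negligible_bigcup => k; apply/negligibleP; last by have [] := HF k.
  apply: measurableD; [exact: borel_lebesgue_measurable|exact: measurableI].
apply: negligibleS => x H; apply: contrapT => nx.
apply: H; split=> [Ax|[k _ Fkx]].
  have [k _ Skx] : (\bigcup_k S k) x by rewrite -ST.
  by exists k => //; have [_ + _] := HF k; apply.
by apply: contrapT => nAx; apply: nx; exists k => //; split => // -[].
Qed.

Lemma lebesgue_ae_eq A B : mleb A -> mleb B ->
  {ae leb, forall x, A x <-> B x} -> leb A = leb B.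
Proof.
move=> mA mB AB; have mY : mleb (A `+` B) by exact: measurableY.
have Y0 : leb (A `+` B) = 0%E.
  apply/negligibleP => //; apply: negligibleS AB.
  by move=> x /setY_iff.
apply/eqP; rewrite eq_le; apply/andP; split.
  rewrite -[leRHS]adde0 -Y0; apply: le_trans (measureU2 _ mB mY).
  apply: le_measure; rewrite ?inE//; first exact: measurableU.
  by move=> x Ax; have [|nB] := pselect (B x); [left|right; left].
rewrite -[leRHS]adde0 -Y0; apply: le_trans (measureU2 _ mA mY).
apply: le_measure; rewrite ?inE//; first exact: measurableU.
by move=> x Ax; have [|nB] := pselect (A x); [left|right; right].
Qed.

Lemma measurable_lebesgue_id :
  measurable_fun [set: lebesgueType n] (fun x => x : 'rV[R]_n).
Proof. by move=> _ B mB; rewrite setTI; exact: borel_lebesgue_measurable. Qed.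

Lemma ge0_integral_lebesgue A B (f : 'rV[R]_n -> \bar R) :
  mleb A -> measurable B -> {ae leb, forall x, A x <-> B x} ->
  measurable_fun setT f -> (forall x, 0 <= f x)%E ->
  (\int[leb]_(x in A) f x = \int[mu]_(x in B) f x)%E.
Proof.
move=> mA mB AB mf f0.
have mB' := borel_lebesgue_measurable mB.
have mY : mleb (A `+` B) by exact: measurableY.
have Y0 : leb (A `+` B) = 0%E.
  apply/negligibleP => //; apply: negligibleS AB.
  by move=> x /setY_iff.
have mfl (D : set (lebesgueType n)) : measurable D ->
    measurable_fun D (f : lebesgueType n -> \bar R).
  move=> mD; apply: measurable_funTS.
  exact: (measurableT_comp mf measurable_lebesgue_id).
rewrite (ge0_negligible_integral mY)//; last exact: mfl.
rewrite [RHS](_ : _ = (\int[leb]_(x in B) f x)%E).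
  rewrite [RHS](ge0_negligible_integral mY)//; last exact: mfl.
  congr (integral _ _ _); apply/seteqP; split=> x /= [Ax nY]; split => //.
    by apply: contrapT => nB; apply: nY; left.
  by apply: contrapT => nA; apply: nY; right.
pose idl : lebesgueType n -> 'rV[R]_n := fun x => x.
have midl : measurable_fun setT idl := measurable_lebesgue_id.
pose m1 : {measure set 'rV[R]_n -> \bar R} := pushforward leb idl.
apply: (@etrans _ _ (\int[m1 midl]_(x in B) f x)%E).
  by apply: eq_measure_integral => D mD _; exact: (esym (lebesgueE mD)).
exact: (ge0_integral_pushforward midl leb mB (measurable_funTS mf) (fun x _ => f0 x)).
Qed.

Definition frac_kernel (s : R) (z : 'rV[R]_n) : \bar R :=
  ((enorm z `^ (n%:R + 2 * s))^-1)%:E.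

Lemma measurable_enorm : measurable_fun setT (@enorm R n).
Proof.
rewrite (_ : @enorm R n = fun x => (\sum_(i < n) x ord0 i ^+ 2) `^ 2^-1).
  apply: (measurableT_comp (measurable_powR _)).
  apply: measurable_sum => i; apply: measurable_funX.
  exact: measurable_coord.
by apply/funext => x; rewrite powR12_sqrt// sumr_ge0// => i _; exact: sqr_ge0.
Qed.

Lemma measurable_frac_kernel s : measurable_fun setT (frac_kernel s).
Proof.
apply/measurable_EFinP; rewrite /frac_kernel.
under eq_fun do rewrite -powRN.
exact: (measurableT_comp (measurable_powR _) measurable_enorm).
Qed.

Lemma frac_kernel_ge0 s z : (0 <= frac_kernel s z)%E.
Proof. by rewrite lee_fin invr_ge0 powR_ge0. Qed.

Lemma frac_kernelN s z : frac_kernel s (- z) = frac_kernel s z.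
Proof.
rewrite /frac_kernel (_ : enorm (- z) = enorm z)// /enorm.
by under eq_bigr do rewrite mxE sqrrN.
Qed.

Lemma interactionE s A B A' B' : mleb A -> mleb B ->
  measurable A' -> measurable B' ->
  {ae leb, forall x, A x <-> A' x} -> {ae leb, forall x, B x <-> B' x} ->
  interaction s A B =
  (\int[mu]_z (frac_kernel s z * mu (A' `&` translate z B')))%E.
Proof.
move=> mA mB mA' mB' AA' BB'.
rewrite -(interaction_cross (measurable_frac_kernel s))//; last exact: frac_kernel_ge0.
pose f (p : lebesgueType n * lebesgueType n) : \bar R :=
  (frac_kernel s (p.2 - p.1)%R * (\1_A p.1)%:E * (\1_B p.2)%:E)%E.
have mfl d (T : measurableType d) (g : T -> lebesgueType n) :
    measurable_fun setT g -> measurable_fun setT (g : T -> 'rV[R]_n).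
  by move=> mg; exact: (measurableT_comp measurable_lebesgue_id mg).
have mf : measurable_fun setT f.
  have mi S : mleb S -> measurable_fun setT (\1_S : @lebesgueType R n -> R).
    exact: measurable_indic.
  apply: emeasurable_funM; [apply: emeasurable_funM|].
  - apply: (measurableT_comp (measurable_frac_kernel s)).
    apply: measurable_rV => i; under eq_fun do rewrite !mxE.
    apply: measurable_funB.
    + exact: (measurableT_comp (measurable_coord i) (mfl _ _ _ measurable_snd)).
    + exact: (measurableT_comp (measurable_coord i) (mfl _ _ _ measurable_fst)).
  - apply/measurable_EFinP.
    exact: (measurableT_comp (mi _ mA) measurable_fst).
  - apply/measurable_EFinP.
    exact: (measurableT_comp (mi _ mB) measurable_snd).
have f0 p : (0 <= f p)%E by rewrite !mule_ge0 ?frac_kernel_ge0// lee_fin.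
rewrite /interaction integral_mkcond.
transitivity (\int[leb \x leb]_p f p)%E.
  apply: eq_integral => p _; rewrite epatch_indic/= /f -frac_kernelN opprB -muleA.
  congr (_ * _)%E; rewrite -EFinM; congr (_%:E).
  by rewrite !indicE in_setX -mulnb natrM.
rewrite (fubini_tonelli1 f mf f0)/fubini_F/=.
have mk (x : 'rV[R]_n) : measurable_fun setT (fun y : 'rV[R]_n => frac_kernel s (y - x)).
  apply: (measurableT_comp (measurable_frac_kernel s)).
  have := measurable_affine 1 (- x); congr measurable_fun.
  by apply/funext => z; rewrite scale1r.
pose g (x : 'rV[R]_n) : \bar R := (\int[mu]_(y in B') frac_kernel s (y - x)%R)%E.
have g0 x : (0 <= g x)%E by apply: integral_ge0 => y _; exact: frac_kernel_ge0.
have mg : measurable_fun setT g.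
  pose F (p : 'rV[R]_n * 'rV[R]_n) : \bar R :=
    (frac_kernel s (p.2 - p.1)%R * (\1_B' p.2)%:E)%E.
  have mF : measurable_fun setT F.
    have miB : measurable_fun setT (\1_B' : 'rV[R]_n -> R).
      exact: measurable_indic.
    apply: emeasurable_funM.
      apply: (measurableT_comp (measurable_frac_kernel s)).
      apply: measurable_rV => i; under eq_fun do rewrite !mxE.
      apply: measurable_funB.
      - exact: (measurableT_comp (measurable_coord i) measurable_snd).
      - exact: (measurableT_comp (measurable_coord i) measurable_fst).
    apply/measurable_EFinP.
    exact: (measurableT_comp miB measurable_snd).
  have := @measurable_fun_fubini_tonelli_F _ _ _ _ _ mu F mF.
  rewrite (_ : fubini_F mu F = g); first apply.
    by move=> p; rewrite mule_ge0 ?frac_kernel_ge0// lee_fin.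
  apply/funext => x; rewrite /fubini_F /g [RHS]integral_mkcond.
  by apply: eq_integral => y _; rewrite epatch_indic.
rewrite -(ge0_integral_lebesgue mA mA' AA' mg g0).
rewrite [RHS]integral_mkcond; apply: eq_integral => x _.
rewrite epatch_indic/= /g -(ge0_integral_lebesgue mB mB' BB' (mk x)); last first.
  by move=> y; exact: frac_kernel_ge0.
pose h (y : lebesgueType n) : \bar R := (frac_kernel s (y - x)%R * (\1_B y)%:E)%E.
have mh : measurable_fun setT h.
  apply: emeasurable_funM.
    exact: (measurableT_comp (mk x) measurable_lebesgue_id).
  by apply/measurable_EFinP; exact: measurable_indic.
have h0 y : (0 <= h y)%E by rewrite mule_ge0 ?frac_kernel_ge0// lee_fin.
have -> : (\int[leb]_(y in B) frac_kernel s (y - x)%R = \int[leb]_y h y)%E.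
  by rewrite integral_mkcond epatch_indic.
have A0 : (0 <= (\1_A x)%:E :> \bar R)%E by rewrite lee_fin.
rewrite -(ge0_integralZr leb measurableT mh (fun y _ => h0 y) A0).
by apply: eq_integral => y _; rewrite /f /h/= muleAC.
Qed.

End completion.

(** * Interaction energy and jumps of the chambers *)

Section chamber.
Context {R : realType} {n : nat}.
Local Notation mu := (@borel_lebesgue R n).
Local Notation leb := (@lebesgue R n).
Local Notation mleb A := (measurable (A : set (lebesgueType n))).

(** Registered so that the almost everywhere statements for [lebesgue] can be
    combined by the lemmas about filters. *)
#[global] Instance lebesgue_ae_filter : Filter (nbhs (almost_everywhere leb)).
Proof. exact: ae_filter_ringOfSetsType. Qed.

Lemma measure_le_sum d (T : measurableType d) (m : {measure set T -> \bar R})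
    (I : finType) (P : pred I) (F : I -> set T) X :
  measurable X -> (forall i, measurable (F i)) ->
  (forall x, X x -> exists2 i, P i & F i x) ->
  (m X <= \sum_(i | P i) m (F i))%E.
Proof.
move=> mX mF XF.
apply: (@le_trans _ _ (m (\big[setU/set0]_(i | P i) F i))).
  apply: le_measure; rewrite ?inE//; first exact: bigsetU_measurable.
  by move=> x /XF[i Pi Fix]; rewrite (bigD1 i)//=; left.
suff [] : measurable (\big[setU/set0]_(i | P i) F i) /\
  (m (\big[setU/set0]_(i | P i) F i) <= \sum_(i | P i) m (F i))%E by [].
apply: (big_rec2 (fun X y => measurable X /\ (m X <= y)%E)).
  by rewrite measure0.
move=> i y U Pi [mU Uy]; split; first exact: measurableU.
by apply: le_trans (measureU2 _ (mF i) mU) _; rewrite leeD2l.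
Qed.

Lemma jumpvol_ge0 (A E : set 'rV[R]_n) h : (0 <= jumpvol A E h)%E.
Proof. exact: measure_ge0. Qed.

(** Pointwise form of the definition: almost every point of O lies in exactly one
    chamber. In this form partitions pass to restrictions and to limits. *)
Lemma is_mpartition_ae m (O : set 'rV[R]_n) (F : 'I_m -> set 'rV[R]_n) :
  open O -> (forall i, mleb (F i)) -> (forall i, F i `<=` O) ->
  is_mpartition O F <->
  {ae leb, forall x, O x -> exists2 i, F i x & forall j, F j x -> j = i}.
Proof.
move=> oO mF FO; have mO := open_lebesgue_measurable oO.
have mU : mleb (\bigcup_(i in [set: 'I_m]) F i).
  by apply: fin_bigcup_measurable => //; exact: finite_finset.
split=> [pF|H].
  have D : {ae leb, forall x, forall i j, i != j -> ~ (F i x /\ F j x)}.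
    apply: filter_forall => i; apply: filter_forall => j.
    have [->|ij] := eqVneq j i; first exact: aeW.
    have : leb.-negligible (F i `&` F j).
      apply/negligibleP; first exact: measurableI.
      by apply: (partition_disj pF); rewrite eq_sym.
    by apply: negligibleS => x /= /not_implyP[_ /contrapT].
  have : leb.-negligible (O `\` \bigcup_(i in [set: 'I_m]) F i).
    apply/negligibleP; last exact: (partition_cover pF).
    exact: measurableD.
  move=> C; have {}C : {ae leb, forall x, O x -> exists i, F i x}.
    apply: negligibleS C => x /= /not_implyP[Ox nF]; split => // -[i _ Fix].
    by apply: nF; exists i.
  apply: filterS2 D C => x Dx Cx /Cx[i Fix]; exists i => // j Fjx.
  by apply: contrapT => /eqP ji; exact: (Dx j i ji).
split => //.
- move=> i j ij; apply/negligibleP; first exact: measurableI.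
  apply: negligibleS H => x /= [Fix Fjx] /(_ (FO i _ Fix))[l _ Hl].
  by move: ij; rewrite (Hl _ Fix) (Hl _ Fjx) eqxx.
- apply/negligibleP; first exact: measurableD.
  apply: negligibleS H => x /= [Ox nF] /(_ Ox)[i Fix _].
  by apply: nF; exists i.
Qed.

(** That B i is exactly, not only up to a null set, the complement of the other
    chambers lets [inner_energy_jump] argue point by point: B i is taken to be the
    complement of the union of the hulls of the others. *)
Lemma borel_partition_chamber m (E : 'I_m -> set 'rV[R]_n) (i : 'I_m) :
  is_mpartition setT E ->
  exists B : 'I_m -> set 'rV[R]_n,
    [/\ forall b, measurable (B b),
        forall b, {ae leb, forall x, E b x <-> B b x} &
        forall x, ~ B i x <-> exists2 b, b != i & B b x].
Proof.
move=> pE.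
have /choice[H HH] (b : 'I_m) : exists B : set 'rV[R]_n,
    measurable B /\ {ae leb, forall x, E b x <-> B x}.
  by have [B] := lebesgue_borel_hull (partition_measurable pE b); exists B.
pose U := \bigcup_(b in [set b | b != i]) H b.
have mU : measurable U.
  by apply: fin_bigcup_measurable; [exact: finite_finset|move=> b _; case: (HH b)].
exists (fun b => if b == i then ~` U else H b); split.
- by move=> b; case: eqP => _; [exact: measurableC|case: (HH b)].
- move=> b; case: eqP => [->|_]; last by case: (HH b).
  have aeH : {ae leb, forall x, forall b, E b x <-> H b x}.
    by apply: filter_forall => b'; case: (HH b').
  have := (is_mpartition_ae openT (partition_measurable pE) (partition_sub pE)).1 pE.
  apply: filterS2 aeH => x xH /(_ I)[b0 Eb0 Hb0]; split.
    by move=> /Hb0 ib0 [b' /eqP b'i] /xH/Hb0; rewrite -ib0.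
  move=> nU; have [<-//|b0i] := eqVneq b0 i.
  by exfalso; apply: nU; exists b0 => //; apply/xH.
- move=> x; rewrite eqxx; split.
    by move=> /contrapT[b bi Hb]; exists b; rewrite // (negbTE bi).
  by move=> [b bi]; rewrite (negbTE bi) => Hb; apply; exists b.
Qed.

(** If x lies in G and exactly one of x, x + z lies in the i-th chamber, then
    (x, x + z) is a pair of points of O in two distinct chambers, one being the
    i-th. Such pairs are counted by the terms (i, b) and (b, i) of the energy,
    whose weights are at least c; the factor 2 is that of the definition of
    [inner_energy]. *)
Lemma inner_energy_jump m (sigma : 'M[R]_m) (c : R)
    (E B : 'I_m -> set 'rV[R]_n) (i : 'I_m) :
  0 <= c -> (forall a b, a != b -> c <= sigma a b) ->
  (forall a, sigma a a = 0) ->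
  (forall b, mleb (E b)) -> (forall b, measurable (B b)) ->
  (forall b, {ae leb, forall x, E b x <-> B b x}) ->
  (forall x, ~ B i x <-> exists2 b, b != i & B b x) ->
  forall (s r : R) (G O : set 'rV[R]_n), measurable G -> open O -> 0 < r ->
  (forall x z, G x -> `|z| < r -> O (x + z)) ->
  (c%:E * \int[mu]_(z in ball (0%R : 'rV[R]_n) r) (frac_kernel s z * jumpvol G (B i) z) <=
   2%:E * inner_energy sigma s E O)%E.
Proof.
move=> c0 sc s0 mE mB EB Bi s r G O mG oO r0 GO.
have mO := open_measurable_rV oO.
pose Q b := B b `&` O.
have mQ b : measurable (Q b) by exact: measurableI.
pose cr a b z := mu (Q a `&` translate z (Q b)).
have cr0 a b z : (0 <= cr a b z)%E by exact: measure_ge0.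
have mcr a b : measurable_fun setT (cr a b) by exact: measurable_cross.
pose I a b := (\int[mu]_z (frac_kernel s z * cr a b z))%E.
have IE a b : interaction s (E a `&` O) (E b `&` O) = I a b.
  have mEO b' : mleb (E b' `&` O).
    by apply: measurableI => //; exact: open_lebesgue_measurable.
  have aeO b' : {ae leb, forall x, (E b' `&` O) x <-> Q b' x}.
    by apply: filterS (EB b') => x EBx; rewrite /Q/=; tauto.
  exact: interactionE.
have I0 a b : (0 <= I a b)%E.
  by apply: integral_ge0 => z _; rewrite mule_ge0 ?frac_kernel_ge0.
pose T a b : \bar R := ((sigma a b)%:E * I a b)%E.
have sg0 a b : 0 <= sigma a b.
  have [->|ab] := eqVneq a b; first by rewrite s0.
  exact: le_trans c0 (sc _ _ ab).
have T0 a b : (0 <= T a b)%E by rewrite mule_ge0// lee_fin.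
have -> : (2%:E * inner_energy sigma s E O = \sum_(a < m) \sum_(b < m) T a b)%E.
  rewrite /inner_energy muleA -EFinM divff// mul1e.
  by apply: eq_bigr => a _; apply: eq_bigr => b _; rewrite IE.
have mkc a b : measurable_fun setT (fun z => frac_kernel s z * cr a b z)%E.
  by apply: emeasurable_funM => //; exact: measurable_frac_kernel.
have kc0 a b z : (0 <= frac_kernel s z * cr a b z)%E by rewrite mule_ge0 ?frac_kernel_ge0.
have main : (\int[mu]_(z in ball (0%R : 'rV[R]_n) r) (frac_kernel s z * jumpvol G (B i) z) <=
   \sum_(b < m | b != i) (I i b + I b i))%E.
  rewrite [leRHS](_ : _ = \int[mu]_z
      (\sum_(b < m | b != i) (frac_kernel s z * cr i b z + frac_kernel s z * cr b i z)))%E; last first.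
    under [RHS]eq_integral do rewrite -big_filter.
    rewrite ge0_integral_sum//; last 2 first.
      by move=> b; exact: emeasurable_funD.
      by move=> b z _; rewrite adde_ge0.
    rewrite -big_filter; apply: eq_bigr => b _; rewrite ge0_integralD//.
  rewrite integral_mkcond; apply: ge0_le_integral => //.
  - by move=> z _; apply: erestrict_ge0 => x _; rewrite mule_ge0 ?frac_kernel_ge0 ?jumpvol_ge0.
  - apply/(measurable_restrictT _ (measurable_ball_rV _ _)); apply: measurable_funTS.
    apply: emeasurable_funM; first exact: measurable_frac_kernel.
    exact: measurable_jumpvol.
  - under eq_fun do rewrite -big_filter.
    by apply: emeasurable_sum => b; exact: emeasurable_funD.
  move=> z _; rewrite patchE; case: ifPn => [|_]; last first.
    by apply: sume_ge0 => b _; rewrite adde_ge0.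
  rewrite inE ball0P => zr.
  under eq_bigr do rewrite -ge0_muleDr//.
  rewrite -ge0_sume_distrr; last by move=> b _; rewrite adde_ge0.
  apply: lee_wpmul2l; first exact: frac_kernel_ge0.
  rewrite /jumpvol; apply: (@le_trans _ _ (\sum_(b < m | b != i)
      mu ((Q i `&` translate z (Q b)) `|` (Q b `&` translate z (Q i))))%E).
    apply: measure_le_sum.
    - by apply: measurableI => //; exact: measurable_jump.
    - by move=> b; apply: measurableU; apply: measurableI => //; exact: measurable_translate.
    move=> x [Gx /setY_iff nB].
    have Ox : O x by have := GO x 0 Gx; rewrite normr0 addr0; exact.
    have Oxz : O (x + z) by exact: GO.
    have [Bx|/[dup] nBx /Bi[b bi Bb]] := pselect (B i x).
      have /Bi[b bi Bb] : ~ B i (x + z) by move=> Bxz; exact: nB.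
      by exists b => //; left.
    by exists b => //; right; split => //; split => //; apply: contrapT => nBz; exact: nB.
  apply: lee_sum => b _; apply: measureU2.
    by apply: measurableI => //; exact: measurable_translate.
  by apply: measurableI => //; exact: measurable_translate.
have c0' : (0 <= c%:E :> \bar R)%E by rewrite lee_fin.
apply: le_trans (lee_wpmul2l c0' main) _.
rewrite ge0_sume_distrr; last by move=> b _; rewrite adde_ge0.
rewrite [leRHS](bigD1 i)//= [X in (_ <= X + _)%E](bigD1 i)//=.
apply: (@le_trans _ _ (\sum_(b < m | b != i) T i b + \sum_(b < m | b != i) T b i)%E).
  rewrite -big_split/=; apply: lee_sum => b bi.
  rewrite ge0_muleDr//; apply: leeD; apply: lee_wpmul2r => //; rewrite lee_fin sc//.
  by rewrite eq_sym.
apply: leeD; first by rewrite leeDr.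
by apply: lee_sum => b bi; rewrite (bigD1 i)//= leeDl// sume_ge0.
Qed.

End chamber.

(** * Dyadic decomposition of the fractional kernel *)

Section dyadic.
Context {R : realType}.

(** The sum runs over the j with 2^j < r / t: a geometric progression of ratio
    at least 2, so at most twice its largest term. *)
Lemma dyadic_sum_le (p r t : R) N : 1 <= p -> 0 < r -> 0 < t ->
  \sum_(j < N) (2 `^ p) ^+ j * (2 ^+ j * t < r)%R%:R <= 2 * (r / t) `^ p.
Proof.
move=> p1 r0.
have p0 : 0 <= p by apply: le_trans p1.
have q2 : 2 <= 2 `^ p :> R.
  by rewrite -[leLHS]powRr1// ler_powR// ler1n.
suff H : forall M u, 0 < u ->
    \sum_(j < M) (2 `^ p) ^+ j * (2 ^+ j * u < r)%R%:R <=
    (if u < r then 2 * (r / u) `^ p - 1 else 0).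
  move=> t0; apply: le_trans (H N t t0) _; case: ifPn => _.
    by rewrite gerBl.
  by rewrite mulr_ge0// powR_ge0.
elim=> [|M IH] u u0.
  rewrite big_ord0; case: ifPn => // ur.
  have : 1 <= (r / u) `^ p.
    by rewrite -[leLHS](powRr0 (r / u)) ler_powR// ler_pdivlMr// mul1r ltW.
  by lra.
rewrite big_ord_recl expr0 !mul1r.
have -> : \sum_(i < M) (2 `^ p) ^+ bump 0 i * (2 ^+ bump 0 i * u < r)%R%:R =
   2 `^ p * \sum_(i < M) (2 `^ p) ^+ i * (2 ^+ i * (2 * u) < r)%R%:R.
  rewrite mulr_sumr; apply: eq_bigr => i _.
  by rewrite /bump/= add1n !exprS -!mulrA; congr (_ * (_ * (_ < _)%R%:R)); ring.
have u20 : 0 < 2 * u by rewrite mulr_gt0.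
have q0 : 0 <= 2 `^ p :> R by rewrite powR_ge0.
have := ler_wpM2l q0 (IH _ u20).
set S := _ * \sum_(_ < _) _ => HS.
case: ifPn HS => [u2r|]; rewrite ?mulr0.
  have ur : u < r by apply: lt_trans u2r; rewrite ltr_pMl// ltr1n.
  rewrite ur => HS.
  have -> : (r / u) `^ p = 2 `^ p * (r / (2 * u)) `^ p.
    rewrite -powRM//; last by rewrite divr_ge0// ltW.
    by congr (_ `^ _); field; rewrite gt_eqF.
  move: HS q2; set x := _ `^ p; set y := _ `^ p; rewrite /= mulrBr mulr1.
  by set xy := x * y; rewrite mulrCA -/xy; lra.
move=> _ HS; case: ifPn => ur /=; last by lra.
have : 1 <= (r / u) `^ p.
  by rewrite -[leLHS](powRr0 (r / u)) ler_powR// ler_pdivlMr// mul1r ltW.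
by lra.
Qed.

(** The ratio b = 2^-a satisfies 1 - b <= a, whence 1/(1-b) >= 1/a; N is so large
    that the partial sum exceeds half of the whole series. With a = 1 - 2s this
    is where the factor 1 - 2s of the energy is compensated. *)
Lemma geometric_sum_lower (a : R) : 0 < a < 1 ->
  exists N, 1 <= 2 * a * \sum_(j < N) (2 `^ (- a)) ^+ j.
Proof.
move=> /andP[a0 a1].
(* convexity of the exponential: 2^-a >= 1 - a ln 2 >= 1 - a *)
pose b := 2 `^ (- a).
have b0 : 0 <= b by rewrite powR_ge0.
have b1a : 1 - b <= a.
  rewrite lerBlDr -lerBlDl /b /powR pnatr_eq0/=.
  apply: le_trans (expR_ge1Dx _).
  rewrite lerD2l mulNr lerN2 ler_piMr ?(ltW a0)//.
  by have := @le_ln1Dx R 1; rewrite (_ : 1 + 1 = 2)//; apply; lra.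
pose N := (Num.trunc a^-1).+1.
have aN : a^-1 < N%:R by rewrite truncnS_gt.
have bN : b ^+ N <= 2^-1.
  rewrite -powR_mulrn// /b -powRrM -[leRHS]powR_inv1//.
  rewrite ler_powR ?ler1n// mulNr lerN2.
  by move: aN; rewrite -(ltr_pM2l a0) mulfV ?gt_eqF// => /ltW.
exists N; have S0 : 0 <= \sum_(j < N) b ^+ j.
  by apply: sumr_ge0 => j _; rewrite exprn_ge0.
have : (1 - b) * \sum_(j < N) b ^+ j = 1 - b ^+ N.
  by rewrite -opprB mulNr -subrX1 opprB.
have := ler_wpM2r S0 b1a; rewrite -/b; set S := \sum_(_ < _) _.
by move=> H1 H2; lra.
Qed.

End dyadic.

Section dyadic_energy.
Context {R : realType} {n : nat}.
Local Notation mu := (@borel_lebesgue R n).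
Local Notation B0 r := (ball (0%R : 'rV[R]_n) r).

Lemma jumpvol0 (A E : set 'rV[R]_n) : jumpvol A E 0 = 0%E.
Proof.
rewrite /jumpvol (_ : _ `&` _ = set0) ?measure0// -subset0 => x [_ /setY_iff H].
by apply: H; rewrite /translate/= addr0.
Qed.

Lemma rV_coord_le (x : 'rV[R]_n) i : `|x ord0 i| <= `|x|.
Proof.
rewrite [leRHS]/Num.norm/= mx_normrE.
by apply/bigmax_geP; right; exists (ord0, i).
Qed.

Lemma enorm_le (x : 'rV[R]_n) : enorm x <= n%:R * `|x|.
Proof.
have nx0 : 0 <= n%:R * `|x| by rewrite mulr_ge0.
rewrite -[leRHS]ger0_norm// -sqrtr_sqr /enorm; apply: ler_wsqrtr.
apply: (@le_trans _ _ (\sum_(i < n) `|x| ^+ 2)).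
  by apply: ler_sum => i _; rewrite -real_normK ?num_real// lerXn2r ?nnegrE ?rV_coord_le.
rewrite sumr_const card_ord -[leLHS]mulr_natl exprMn ler_wpM2r ?sqr_ge0//.
by rewrite -natrX ler_nat; case: (n) => // k; rewrite expnS leq_pmulr.
Qed.

Lemma enorm_gt0 (x : 'rV[R]_n) : x != 0 -> 0 < enorm x.
Proof.
move=> x0; have [i xi] : exists i, x ord0 i != 0.
  apply/existsP; rewrite -negb_forall; apply: contra x0 => /forallP x0.
  by apply/eqP/rowP => i; rewrite mxE; exact/eqP.
rewrite sqrtr_gt0 (bigD1 i)//= ltr_pwDl//.
  by rewrite lt_def sqrf_eq0 xi sqr_ge0.
by apply: sumr_ge0 => j _; exact: sqr_ge0.
Qed.

(** The kernel dominates a superposition of the indicators of the balls of radius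
    r / 2^j. These are balls of the sup norm, hence the factor n^(n+1), an upper
    bound for n^(n+2s). *)
Lemma frac_kernel_lower (s r : R) (z : 'rV[R]_n) N : (0 < n)%N ->
  0 < s < 1 / 2 -> 0 < r -> z != 0 ->
  (((2 * n%:R ^+ n.+1 * r `^ (n%:R + 2 * s))^-1 *
   \sum_(j < N) (2 `^ (n%:R + 2 * s)) ^+ j * (2 ^+ j * `|z| < r)%R%:R)%:E <=
  frac_kernel s z)%E.
Proof.
move=> n0 /andP[s0 s1] r0 z0; rewrite lee_fin.
have n1 : 1 <= n%:R :> R by rewrite ler1n.
set p := n%:R + 2 * s.
have p1 : 1 <= p by rewrite /p; lra.
have p0 : 0 <= p by lra.
have pn : p <= n.+1%:R by rewrite -natr1 /p; lra.
have t0 : 0 < `|z| by rewrite normr_gt0.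
have D0 : 0 < 2 * n%:R ^+ n.+1 * r `^ p.
  by rewrite !mulr_gt0// ?powR_gt0// exprn_gt0// ltr0n.
rewrite -ler_pdivlMl ?invr_gt0// invrK.
apply: le_trans (dyadic_sum_le N p1 r0 t0) _.
have -> : (r / `|z|) `^ p = r `^ p / `|z| `^ p.
  rewrite powRM ?invr_ge0 ?(ltW r0)//; congr (_ * _).
  by rewrite -[X in X `^ _]powR_inv1// -powRrM mulN1r powRN.
have tp0 : 0 < `|z| `^ p by rewrite powR_gt0.
have e0 : 0 < enorm z `^ p by rewrite powR_gt0// enorm_gt0.
have K : enorm z `^ p <= n%:R ^+ n.+1 * `|z| `^ p.
  apply: (@le_trans _ _ ((n%:R * `|z|) `^ p)).
    by apply: ge0_ler_powR; rewrite ?nnegrE ?sqrtr_ge0 ?mulr_ge0 ?enorm_le.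
  rewrite powRM// ler_wpM2r ?powR_ge0// -powR_mulrn//.
  by rewrite ler_powR.
rewrite mulrA ler_pdivrMr// mulrAC -mulrA -[leRHS]mulrA.
rewrite -[leRHS]mulrA ler_pM2l// mulrCA ler_pMr ?powR_gt0//.
by rewrite mulrA ler_pdivlMr// mul1r.
Qed.

(** [jumpvol_chain] with 2^j segments loses a factor 2^j, and the change of
    variables z = 2^j w a factor 2^(jn). *)
Lemma dyadic_scale_jump (A G E : set 'rV[R]_n) (r : R) (j : nat) : 0 < r ->
  measurable A -> measurable G -> measurable E ->
  (forall x z, A x -> `|z| < r -> G (x + z)) ->
  ((((2 ^+ j) ^+ n.+1)^-1)%:E * \int[mu]_(z in B0 r) jumpvol A E z <=
   \int[mu]_(z in B0 (r / 2 ^+ j)) jumpvol G E z)%E.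
Proof.
move=> r0 mA mG mE AG.
pose b : R := 2 ^+ j; have b0 : 0 < b by rewrite exprn_gt0.
have mJ X : measurable X -> measurable_fun setT (jumpvol X E).
  by move=> mX; exact: measurable_jumpvol.
pose f z := ((jumpvol G E) \_ (B0 (r / b))) z.
have mf : measurable_fun setT f.
  apply/(measurable_restrictT _ (measurable_ball_rV _ _)); apply: measurable_funTS.
  exact: mJ.
have f0 z : (0 <= f z)%E by apply: erestrict_ge0 => y _; exact: jumpvol_ge0.
rewrite [leRHS]integral_mkcond -/f.
have ib0 : 0 < b^-1 by rewrite invr_gt0.
have := ge0_integral_affine 0 ib0 mf f0.
rewrite exprVn invrK => /(congr1 (fun x => ((b ^+ n)^-1)%:E * x)%E).
rewrite muleA -EFinM mulVf ?mul1e ?expf_neq0 ?gt_eqF// => <-.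
rewrite exprS invfM mulrC EFinM -muleA; apply: lee_wpmul2l.
  by rewrite lee_fin invr_ge0 exprn_ge0// ltW.
have ib0' : (0 <= (b^-1)%:E)%E by rewrite lee_fin ltW.
rewrite -(ge0_integralZl mu (measurable_ball_rV 0 r)
  (measurable_funTS (mJ _ mA)) (fun z _ => jumpvol_ge0 _ _ z) ib0').
rewrite integral_mkcond; apply: ge0_le_integral => //.
- by move=> z _; apply: erestrict_ge0 => y _;
    rewrite mule_ge0 ?jumpvol_ge0// lee_fin ltW.
- apply/(measurable_restrictT _ (measurable_ball_rV _ _)); apply: measurable_funTS.
  by apply: emeasurable_funM => //; exact: mJ.
- by apply: (measurableT_comp mf); exact: measurable_affine.
move=> z _; rewrite patchE; case: ifPn => [|_]; last exact: f0.
rewrite inE ball0P => zr; rewrite /f patchE ifT; last first.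
  rewrite inE ball0P addr0 normrZ ger0_norm ?(ltW ib0)//.
  by rewrite mulrC ltr_pM2r.
rewrite addr0.
have bN : b = (2 ^ j)%:R by rewrite natrX.
have := @jumpvol_chain R n (2 ^ j) A G E z; rewrite -bN expn_gt0 /= => H.
rewrite lee_pdivrMl//; apply: H => // x t /andP[t0 t1] Ax.
apply: AG => //; apply: le_lt_trans zr; rewrite normrZ ger0_norm//.
by rewrite ler_piMl.
Qed.

(** At the scale j the kernel has weight 2^(j(n+2s)) and, by [dyadic_scale_jump],
    the jumps a share 2^(-j(n+1)) of X, the integral of the jumps over B_r: the
    product is 2^(-j(1-2s)). *)
Lemma kernel_jump_lower (s r : R) (A G E : set 'rV[R]_n) N : (0 < n)%N ->
  0 < s < 1 / 2 -> 0 < r ->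
  measurable A -> measurable G -> measurable E ->
  (forall x z, A x -> `|z| < r -> G (x + z)) ->
  (((2 * n%:R ^+ n.+1 * r `^ (n%:R + 2 * s))^-1 *
    \sum_(j < N) (2 `^ (- (1 - 2 * s))) ^+ j)%:E *
     \int[mu]_(z in B0 r) jumpvol A E z <=
   \int[mu]_(z in B0 r) (frac_kernel s z * jumpvol G E z))%E.
Proof.
move=> n0 hs r0 mA mG mE AG.
set K := (_ * _ * _)^-1; set p := n%:R + 2 * s.
have K0 : 0 <= K by rewrite invr_ge0 !mulr_ge0 ?exprn_ge0 ?powR_ge0.
pose X := (\int[mu]_(z in B0 r) jumpvol A E z)%E.
have X0 : (0 <= X)%E by apply: integral_ge0 => z _; exact: jumpvol_ge0.
pose q : R := 2 `^ p; have q0 : 0 <= q by exact: powR_ge0.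
pose g j z : \bar R := ((K * q ^+ j)%:E * (jumpvol G E \_ (B0 (r / 2 ^+ j))) z)%E.
have mr j : measurable_fun setT (jumpvol G E \_ (B0 (r / 2 ^+ j))).
  apply/(measurable_restrictT _ (measurable_ball_rV _ _)); apply: measurable_funTS.
  exact: measurable_jumpvol.
have r0' j z : (0 <= (jumpvol G E \_ (B0 (r / 2 ^+ j))) z)%E.
  by apply: erestrict_ge0 => y _; exact: jumpvol_ge0.
have mg j : measurable_fun setT (g j) by exact: emeasurable_funM.
have Kq0 j : 0 <= K * q ^+ j by rewrite mulr_ge0// exprn_ge0.
have g0 j z : (0 <= g j z)%E by rewrite mule_ge0// lee_fin.
apply: (@le_trans _ _ (\int[mu]_z \sum_(j < N) g j z)%E).
  rewrite ge0_integral_sum// mulr_sumr -sumEFin ge0_sume_distrl; last first.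
    by move=> j _; rewrite lee_fin mulr_ge0// exprn_ge0// powR_ge0.
  apply: lee_sum => j _; rewrite /g ge0_integralZl// ?lee_fin//.
  rewrite -integral_mkcond.
  apply: le_trans (lee_wpmul2l _ (dyadic_scale_jump j r0 mA mG mE AG)); last first.
    by rewrite lee_fin.
  rewrite muleA -EFinM -/X lee_wpmul2r// lee_fin.
  rewrite -mulrA ler_wpM2l//.
  have -> : 2 `^ (- (1 - 2 * s)) = q / 2 ^+ n.+1.
    rewrite /q -powR_mulrn// -powRN -powRD ?pnatr_eq0 ?implybT//.
    by congr (_ `^ _); rewrite /p -natr1; ring.
  by rewrite exprMn exprVn -!exprM mulnC.
rewrite [leRHS]integral_mkcond; apply: ge0_le_integral => //.
- by move=> z _; apply: sume_ge0 => j _.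
- by apply: emeasurable_sum => j; exact: mg.
- apply/(measurable_restrictT _ (measurable_ball_rV _ _)); apply: measurable_funTS.
  apply: emeasurable_funM; first exact: measurable_frac_kernel.
  exact: measurable_jumpvol.
move=> z _.
have [->|z0] := eqVneq z 0.
  rewrite big1; last first.
    move=> j _; rewrite /g patchE jumpvol0; case: ifP => _; exact: mule0.
  by apply: erestrict_ge0 => y _; rewrite mule_ge0 ?frac_kernel_ge0 ?jumpvol_ge0.
have [zr|zr] := pselect (B0 r z); last first.
  rewrite big1; last first.
    move=> j _; rewrite /g patchE ifF ?mule0//; apply/negbTE/negP.
    rewrite inE ball0P => H; apply: zr; apply/ball0P; apply: lt_le_trans H _.
    by rewrite ler_pdivrMr ?exprn_gt0// ler_peMr ?(ltW r0)// exprn_ege1// ler1n.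
  by apply: erestrict_ge0 => y _; rewrite mule_ge0 ?frac_kernel_ge0 ?jumpvol_ge0.
rewrite [leRHS]patchE mem_set//.
apply: le_trans (lee_wpmul2r (jumpvol_ge0 _ _ _) (frac_kernel_lower N n0 hs r0 z0)).
rewrite -/K -/p -/q mulr_sumr -sumEFin ge0_sume_distrl; last first.
  by move=> j _; rewrite lee_fin mulr_ge0// mulr_ge0// exprn_ge0.
apply: lee_sum => j _; rewrite /g patchE; case: ifPn => [|_]; last first.
  by rewrite mule0 mule_ge0 ?jumpvol_ge0// lee_fin mulr_ge0// mulr_ge0// exprn_ge0.
rewrite inE ball0P ltr_pdivlMr ?exprn_gt0// mulrC => ->.
by rewrite mulr1.
Qed.

End dyadic_energy.

(** * Uniform jump bounds on compact sets *)

Section neighborhoods.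
Context {R : realType} {n : nat}.
Implicit Types (K : set 'rV[R]_n).

Definition nbd K (r : R) := \bigcup_(x in K) ball x r.

Lemma nbd_open K r : open (nbd K r).
Proof. by apply: bigcup_open => x _; exact: ball_open. Qed.

Lemma sub_nbd K r : 0 < r -> K `<=` nbd K r.
Proof. by move=> r0 x Kx; exists x => //; exact: ballxx. Qed.

Lemma nbd_add K (r1 r2 r : R) x z : nbd K r1 x -> `|z| < r2 -> r1 + r2 <= r ->
  nbd K r (x + z).
Proof.
move=> [y Ky xy] zr r12; exists y => //; apply: le_ball r12 _ _.
apply: (ball_triangle xy); rewrite mx_norm_ball /ball_/=.
by rewrite opprD addrA subrr sub0r normrN.
Qed.

Lemma closure_nbd K (r1 r2 : R) : r1 < r2 -> closure (nbd K r1) `<=` nbd K r2.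
Proof.
move=> r12 x cx; have r0 : 0 < r2 - r1 by rewrite subr_gt0.
have [y [[z Kz yz] xy]] := cx _ (nbhsx_ballx x _ r0).
exists z => //; rewrite -(subrKC r1 r2).
exact: ball_triangle yz (ball_sym xy).
Qed.

(** Compactness of K makes uniform the radius of the balls contained in O. *)
Lemma compact_nbd_sub K (O : set 'rV[R]_n) : compact K -> open O -> K `<=` O ->
  exists2 r, 0 < r & nbd K r `<=` O.
Proof.
move=> cK oO KO.
have /compact_near_coveringP := cK.
move=> /(_ R (0^'+)%R (fun r x => ball x r `<=` O) _).
have H : forall x, K x -> \forall x' \near x & r \near 0^'+, ball x' r `<=` O.
  move=> x Kx.
  have [e /= e0 xeO] : exists2 e : R, 0 < e & ball x e `<=` O.
    by apply/nbhs_ballP; move: oO; rewrite openE => /(_ _ (KO _ Kx)).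
  have e20 : 0 < e / 2 by rewrite divr_gt0.
  exists (ball x (e / 2), [set r | r <= e / 2]).
    by split; [exact: nbhsx_ballx|exact: nbhs_right_le].
  move=> [x' r] /= [xx' re] y x'y; apply: xeO; rewrite (splitr e).
  exact: ball_triangle xx' (le_ball re x'y).
move=> /(_ H) Hr.
near (0%R : R)^'+ => r; exists r; first by near: r; exact: nbhs_right_gt.
move=> y [x Kx xy]; have KB : K `<=` (fun x => ball x r `<=` O) by near: r.
exact: (KB x Kx).
Unshelve. all: by end_near. Qed.

Lemma bounded_nbd K r : compact K -> bounded_set (nbd K r).
Proof.
move=> cK; have [M [_ /(_ (M + 1)%R)]] := compact_bounded cK.
rewrite ltrDl => /(_ ltr01) KM; exists (M + 1 + r); split; first exact: num_real.
move=> N MN x [y Ky xy]; apply: ltW; apply: le_lt_trans MN.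
rewrite -(subrKC y x); apply: le_trans (ler_normD _ _) _.
apply: lerD; first exact: KM.
by move: xy; rewrite mx_norm_ball /ball_/= distrC => /ltW.
Qed.

Lemma compactly_included_nbd K (O : set 'rV[R]_n) (r1 r2 : R) : compact K ->
  r1 < r2 -> nbd K r2 `<=` O -> compactly_included (nbd K r1) O.
Proof.
move=> cK r12 KO; split; last exact: subset_trans (closure_nbd r12) KO.
apply: bounded_closed_compact; last exact: closed_closure.
have [M [Mr HM]] := bounded_nbd r2 cK.
by exists M; split => // N MN x /(closure_nbd r12); exact: HM.
Qed.

Lemma compact_measurable_rV K : compact K -> measurable K.
Proof.
move=> cK; rewrite -(setCK K); apply: measurableC; apply: open_measurable_rV.
by rewrite openC; apply: compact_closed => //; exact: norm_hausdorff.
Qed.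

End neighborhoods.

Section jump_bounds.
Context {R : realType} {n : nat}.
Local Notation mu := (@borel_lebesgue R n).
Local Notation leb := (@lebesgue R n).
Local Notation B0 r := (ball (0%R : 'rV[R]_n) r).

(** [kernel_jump_lower] combined with the lower bound 1 / (2(1-2s)) of the
    geometric sum: (1-2s) times the energy bounds the average jump. *)
Lemma jump_average_bound (c s r : R) (A G C : set 'rV[R]_n) (en : \bar R) :
  (0 < n)%N -> 0 < s < 1 / 2 -> 0 < r -> 0 <= c -> (0 <= en)%E ->
  measurable A -> measurable G -> measurable C ->
  (forall x z, A x -> `|z| < r -> G (x + z)) ->
  (c%:E * \int[mu]_(z in B0 r) (frac_kernel s z * jumpvol G C z) <= 2%:E * en)%E ->
  (c%:E * \int[mu]_(z in B0 r) jumpvol A C z <=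
   (8 * n%:R ^+ n.+1 * r `^ (n%:R + 2 * s))%:E * ((1 - 2 * s)%:E * en))%E.
Proof.
move=> n0 hs r0 c0 en0 mA mG mC AG H.
have a01 : 0 < 1 - 2 * s < 1 by move/andP: hs => [? ?]; apply/andP; split; lra.
have a0 : 0 < 1 - 2 * s by move/andP: a01 => [].
have [N] := geometric_sum_lower a01; set S := \sum_(_ < _) _ => HS.
have := kernel_jump_lower N n0 hs r0 mA mG mC AG.
rewrite -/S; set D := _ * _ * _ => HK.
have D0 : 0 < D by rewrite !mulr_gt0 ?exprn_gt0 ?powR_gt0 ?ltr0n.
pose X := (\int[mu]_(z in B0 r) jumpvol A C z)%E.
have X0 : (0 <= X)%E by apply: integral_ge0 => z _; exact: jumpvol_ge0.
have c0' : (0 <= c%:E :> \bar R)%E by rewrite lee_fin.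
have := le_trans (lee_wpmul2l c0' HK) H.
have k0 : (0 <= (2 * (1 - 2 * s) * D)%:E :> \bar R)%E.
  by rewrite lee_fin; apply/ltW; apply: mulr_gt0 => //; exact: mulr_gt0.
move=> /(lee_wpmul2l k0).
rewrite -/X !muleA -!EFinM => H2.
apply: (@le_trans _ _ ((2 * (1 - 2 * s) * D * c * (D^-1 * S))%:E * X)%E).
  apply: lee_wpmul2r => //; rewrite lee_fin.
  have -> : 2 * (1 - 2 * s) * D * c * (D^-1 * S) = c * (2 * (1 - 2 * s) * S).
    by field; rewrite gt_eqF.
  by rewrite ler_peMr.
apply: le_trans H2 _; apply: lee_wpmul2r => //; rewrite lee_fin.
by rewrite /D; rewrite le_eqVlt; apply/orP; left; apply/eqP; ring.
Qed.

(** Integrate over k in B_r the inequality J(h) <= J(k) + J(h + k) of [jumpvolD];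
    both k and h + k stay in B_2r. *)
Lemma jump_pointwise (A G C : set 'rV[R]_n) (r : R) h : 0 < r ->
  measurable A -> measurable G -> measurable C ->
  (forall x z, A x -> `|z| < r -> G (x + z)) -> `|h| < r ->
  (((2 * r) ^+ n)%:E * jumpvol A C h <=
   2%:E * \int[mu]_(z in B0 (2 * r)) jumpvol G C z)%E.
Proof.
move=> r0 mA mG mC AG hr.
have mJ : measurable_fun setT (jumpvol G C) by exact: measurable_jumpvol.
have mJh : measurable_fun setT (fun k => jumpvol G C (h + k)).
  apply: (measurableT_comp mJ); have := measurable_affine 1 h.
  by congr measurable_fun; apply/funext => k; rewrite scale1r addrC.
have AG0 : A `<=` G by move=> x Ax; have := AG x 0 Ax; rewrite normr0 addr0; exact.
have AGh : A `<=` translate h G by move=> x Ax; exact: AG.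
have mB t := measurable_ball_rV (0 : 'rV[R]_n) t.
rewrite -(borel_lebesgue_ball 0 r0) muleC -integral_cst//.
apply: (@le_trans _ _ (\int[mu]_(k in B0 r) (jumpvol G C k + jumpvol G C (h + k)%R))%E).
  apply: ge0_le_integral => //.
  - by apply: measurable_funTS; exact: emeasurable_funD.
  - by move=> k _; exact: jumpvolD.
have J0 (k : 'rV[R]_n) : B0 r k -> (0 <= jumpvol G C k)%E.
  by move=> _; exact: jumpvol_ge0.
have J0h (k : 'rV[R]_n) : B0 r k -> (0 <= jumpvol G C (h + k)%R)%E.
  by move=> _; exact: jumpvol_ge0.
rewrite (ge0_integralD mu (mB r) J0 (measurable_funTS mJ) J0h (measurable_funTS mJh)).
rewrite mule_natl mule2n; apply: leeD.
  apply: ge0_subset_integral => //.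
  - exact: measurable_funTS.
  - by apply: le_ball; lra.
pose f := (jumpvol G C) \_ (B0 (2 * r)).
have mf : measurable_fun setT f.
  by apply/(measurable_restrictT _ (mB _)); exact: measurable_funTS.
have f0 z : (0 <= f z)%E by apply: erestrict_ge0 => y _; exact: jumpvol_ge0.
rewrite [leRHS]integral_mkcond -/f -(ge0_integral_translate h mf f0).
rewrite integral_mkcond; apply: ge0_le_integral => //.
- by move=> z _; apply: erestrict_ge0 => y _; exact: jumpvol_ge0.
- by apply/(measurable_restrictT _ (mB _)); exact: measurable_funTS.
- apply: (measurableT_comp mf); have := measurable_affine 1 h.
  by congr measurable_fun; apply/funext => k; rewrite scale1r.
move=> z _; rewrite patchE; case: ifPn => [|_]; last exact: f0.
rewrite inE ball0P => zr; rewrite /f patchE ifT ?(addrC z)//.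
rewrite inE ball0P; apply: le_lt_trans (ler_normD _ _) _; lra.
Qed.

Definition locally_bounded_energy m (Omega : set 'rV[R]_n) (sigma : 'M[R]_m)
    (s : nat -> R) (E : nat -> mpartition m [set: 'rV[R]_n]) :=
  forall Omega', open Omega' -> compactly_included Omega' Omega ->
    (ereal_sup (range (fun k =>
       (1 - 2 * s k)%:E * inner_energy sigma (s k) (E k) Omega')) < +oo)%E.

(** The radii leave room between the three sets K, A and G: the pointwise bound is
    obtained on K from averages on A = nbd K r0, and these from the energy of
    nbd K (5 r0) through G = nbd K (3 r0). *)
Lemma uniform_jump_bounds m (Omega K : set 'rV[R]_n) (sigma : 'M[R]_m)
    (s : nat -> R) (E : nat -> mpartition m [set: 'rV[R]_n]) : (0 < n)%N ->
  open Omega -> compact K -> K `<=` Omega -> surface_tensions sigma ->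
  (forall k, 0 < s k < 1 / 2) ->
  locally_bounded_energy Omega sigma s E ->
  exists r0 M : R, [/\ 0 < r0, 0 <= M & forall k i,
    exists C, [/\ measurable C, {ae leb, forall x, E k i x <-> C x},
      (forall r, 0 < r <= r0 -> (\int[mu]_(z in B0 r) jumpvol K C z <=
         (M * r `^ (n%:R + 2 * s k))%:E)%E) &
      (forall r h, 0 < r <= r0 -> `|h| < r ->
         (jumpvol K C h <= (M * r `^ (2 * s k))%:E)%E)]].
Proof.
move=> n0 oO cK KO hsig hs Eb.
have [rho rho0 KrO] := compact_nbd_sub cK oO KO.
(* 5 r0 < rho leaves nbd K (5 r0) compactly included in Omega *)
pose r0 := rho / 6; have r00 : 0 < r0 by rewrite divr_gt0.
pose O := nbd K (5 * r0).
have OO : compactly_included O Omega.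
  by apply: (compactly_included_nbd (r2 := rho)) => //; rewrite /r0; lra.
have oNO : open O by exact: nbd_open.
have := Eb O oNO OO; set sup := ereal_sup _ => supoo.
have en0 k : (0 <= inner_energy sigma (s k) (E k) O)%E.
  rewrite /inner_energy mule_ge0// ?lee_fin// sume_ge0// => a _.
  apply: sume_ge0 => b _; apply: mule_ge0.
    rewrite lee_fin; have [_ sd sp] := hsig.
    by have [->|ab] := eqVneq a b; rewrite ?sd// ltW// sp.
  by apply: integral_ge0 => z _; rewrite lee_fin invr_ge0 powR_ge0.
have ek0 k : (0 <= (1 - 2 * s k)%:E * inner_energy sigma (s k) (E k) O)%E.
  rewrite mule_ge0// lee_fin; have /andP[? ?] := hs k; lra.
have [M0 [M00 HM0]] : exists M0 : R, 0 <= M0 /\ forall k,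
    ((1 - 2 * s k)%:E * inner_energy sigma (s k) (E k) O <= M0%:E)%E.
  have ub k : ((1 - 2 * s k)%:E * inner_energy sigma (s k) (E k) O <= sup)%E.
    by apply: ereal_sup_ubound; exists k.
  have sup0 : (0 <= sup)%E := le_trans (ek0 0%N) (ub 0%N).
  exists (fine sup); split; first exact: fine_ge0.
  by move=> k; rewrite fineK ?ge0_fin_numE.
have [c [c0 hc]] : exists c : R, 0 < c /\ forall a b, a != b -> c <= sigma a b.
  exists (\big[Num.min/1]_(p : 'I_m * 'I_m | p.1 != p.2) sigma p.1 p.2); split.
    apply: (big_ind (fun x => 0 < x)); first exact: ltr01.
      by move=> x y x0 y0; rewrite lt_min x0.
    by move=> [a b] /= ab; have [_ _ +] := hsig; exact.
  by move=> a b ab; rewrite (bigD1 (a, b))//= ge_min lexx.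
pose D := c^-1 * (8 * n%:R ^+ n.+1) * M0.
have D0 : 0 <= D by rewrite !mulr_ge0 ?invr_ge0 ?exprn_ge0// ltW.
exists r0, (2 ^+ n.+2 * D); split => //; first by rewrite mulr_ge0// exprn_ge0.
move=> k i; have pE := chamberP (E k).
have [B [mB EB Bi]] := borel_partition_chamber i pE.
pose A := nbd K r0; pose G := nbd K (3 * r0).
have mA : measurable A by apply: open_measurable_rV; exact: nbd_open.
have mG : measurable G by apply: open_measurable_rV; exact: nbd_open.
have mK := compact_measurable_rV cK.
have XA r : 0 < r <= r0 -> (\int[mu]_(z in B0 (2 * r)) jumpvol A (B i) z <=
    (D * (2 * r) `^ (n%:R + 2 * s k))%:E)%E.
  move=> /andP[rp rr0]; have r20 : 0 < 2 * r by rewrite mulr_gt0.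
  have [_ sd sp] := hsig.
  have GO x z : G x -> `|z| < 2 * r -> O (x + z).
    by move=> Gx zr; apply: nbd_add Gx zr _; lra.
  have AG x z : A x -> `|z| < 2 * r -> G (x + z).
    by move=> Ax zr; apply: nbd_add Ax zr _; lra.
  have H1 := inner_energy_jump (ltW c0) hc sd (partition_measurable pE)
    mB EB Bi (s k) mG oNO r20 GO.
  have H2 := jump_average_bound n0 (hs k) r20 (ltW c0) (en0 k) mA mG (mB i) AG H1.
  have c0' : (0 <= (c^-1)%:E :> \bar R)%E by rewrite lee_fin invr_ge0 ltW.
  have := lee_wpmul2l c0' H2.
  rewrite muleA -EFinM mulVf ?gt_eqF// mul1e => H3; apply: le_trans H3 _.
  have C0 : (0 <= (c^-1 * (8 * n%:R ^+ n.+1 * (2 * r) `^ (n%:R + 2 * s k)))%:E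
      :> \bar R)%E.
    by rewrite lee_fin !mulr_ge0 ?invr_ge0 ?exprn_ge0 ?powR_ge0// ltW.
  rewrite muleA -EFinM; apply: le_trans (lee_wpmul2l C0 (HM0 k)) _.
  by rewrite -EFinM lee_fin /D; rewrite le_eqVlt; apply/orP; left; apply/eqP; ring.
have s01 : 0 <= 2 * s k <= 1 by have /andP[? ?] := hs k; apply/andP; split; lra.
have /andP[s0 s1] := s01.
have KA : K `<=` A by exact: sub_nbd.
have mB0 t := measurable_ball_rV (0 : 'rV[R]_n) t.
exists (B i); split => //.
- move=> r rr0; have /andP[rp _] := rr0.
  apply: (@le_trans _ _ (\int[mu]_(z in B0 (2 * r)) jumpvol A (B i) z)%E).
    apply: (@le_trans _ _ (\int[mu]_(z in B0 r) jumpvol A (B i) z)%E).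
      apply: ge0_le_integral => //.
      - by apply: measurable_funTS; exact: measurable_jumpvol.
      - by apply: measurable_funTS; exact: measurable_jumpvol.
      - by move=> z _; exact: jumpvolS.
    apply: ge0_subset_integral => //.
    - by apply: measurable_funTS; exact: measurable_jumpvol.
    - by apply: le_ball; lra.
  apply: le_trans (XA r rr0) _; rewrite lee_fin powRM ?(ltW rp)//.
  rewrite mulrCA mulrA ler_wpM2r ?powR_ge0// ler_wpM2r//.
  rewrite -powR_mulrn// ler_powR ?ler1n// -[n.+2]addn2 natrD; lra.
- move=> r h rr0 hr; have /andP[rp rr] := rr0.
  have KG x z : K x -> `|z| < r -> A (x + z).
    move=> Kx zr; exists x => //; apply: le_ball rr _ _.
    by rewrite mx_norm_ball /ball_/= opprD addrA subrr sub0r normrN.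
  have := jump_pointwise rp mK mA (mB i) KG hr.
  have r2n : 0 < (2 * r) ^+ n by rewrite exprn_gt0// mulr_gt0.
  rewrite -lee_pdivlMl//; move=> /le_trans; apply.
  apply: (@le_trans _ _ (((2 * r) ^- n)%:E *
      (2%:E * (D * (2 * r) `^ (n%:R + 2 * s k))%:E))%E).
    by rewrite lee_wpmul2l ?lee_fin ?invr_ge0 ?(ltW r2n)// lee_wpmul2l// XA.
  rewrite -!EFinM lee_fin.
  have r2 : 2 * r != 0 by rewrite mulf_neq0// gt_eqF.
  rewrite powRD; last by rewrite r2 implybT.
  rewrite powR_mulrn ?mulr_ge0 ?(ltW rp)//.
  have -> : (2 * r) ^- n * (2 * (D * ((2 * r) ^+ n * (2 * r) `^ (2 * s k)))) =
     2 * D * (2 * r) `^ (2 * s k) by field; rewrite ?expf_neq0.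
  rewrite powRM ?(ltW rp)// mulrA ler_wpM2r ?powR_ge0//.
  rewrite mulrAC ler_wpM2r//.
  apply: (@le_trans _ _ (2 * 2)).
    by rewrite ler_wpM2l// -[leRHS]powRr1// ler_powR// ler1n.
  by rewrite !exprS mulrA ler_peMr// exprn_ege1// ler1n.
Qed.

End jump_bounds.

(** * Relatively compact sets of indicators in the local L1 topology *)

Section exhaustion.
Context {R : realType} {n : nat}.
Implicit Types (K O : set 'rV[R]_n).

(** Compact sets exhausting the open set O, as points of bounded norm and at
    distance at least 1/(j+1) from the complement of O. *)
Definition exhaust O (j : nat) : set 'rV[R]_n :=
  [set x | `|x| <= j%:R /\ ball x (j.+1%:R^-1) `<=` O].

Lemma exhaust_compact O j : compact (exhaust O j).
Proof.
apply: bounded_closed_compact.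
  exists j%:R; split; first exact: num_real.
  by move=> N jN x [xj _]; apply: ltW; apply: le_lt_trans jN.
move=> x cx; split.
  apply/ler_addgt0Pr => e e0.
  have [y [[yj _] xy]] := cx _ (nbhsx_ballx x _ e0).
  rewrite -(subrKC y x) (le_trans (ler_normD _ _))// lerD//.
  by move: xy; rewrite mx_norm_ball /ball_/= => /ltW.
move=> y; rewrite mx_norm_ball /ball_/= => xy.
have e0 : 0 < j.+1%:R^-1 - `|x - y| by rewrite subr_gt0.
have [z [[_ zO] xz]] := cx _ (nbhsx_ballx x _ e0).
apply: zO; move: xz; rewrite mx_norm_ball /ball_/= => xz.
rewrite -(subrKA x z) addrC (le_lt_trans (ler_normD _ _))// (distrC z).
by rewrite -ltrBrDl.
Qed.

Lemma exhaust_sub O j : exhaust O j `<=` O.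
Proof. by move=> x [_]; apply; apply: ballxx; rewrite invr_gt0. Qed.

Lemma exhaustS O j l : (j <= l)%N -> exhaust O j `<=` exhaust O l.
Proof.
move=> jl x [xj xO]; split; first by rewrite (le_trans xj)// ler_nat.
move=> y xy; apply: xO; apply: le_ball xy.
by rewrite lef_pV2 ?posrE// ler_nat.
Qed.

Lemma sub_exhaust O K : open O -> compact K -> K `<=` O ->
  exists j, K `<=` exhaust O j.
Proof.
move=> oO cK KO; have [r r0 KrO] := compact_nbd_sub cK oO KO.
have [M [_ /(_ (M + 1)%R)]] := compact_bounded cK.
rewrite ltrDl => /(_ ltr01) KM.
have [j1 _ /(_ j1 (leqnn _)) /= j1r] := near_infty_natSinv_lt (PosNum r0).
pose j := maxn j1 (Num.trunc (M + 1)).+1.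
exists j => x Kx; split.
  apply: le_trans (KM x Kx) _; apply: ltW; apply: lt_le_trans (truncnS_gt _) _.
  by rewrite ler_nat leq_maxr.
move=> y xy; apply: KrO; exists x => //; apply: le_ball xy; apply: le_trans (ltW j1r).
by rewrite lef_pV2 ?posrE// ler_nat ltnS leq_maxl.
Qed.

Lemma exhaust_cover O x : open O -> O x -> exists j, exhaust O j x.
Proof.
move=> oO Ox; have [|y ->//|j Kj] := @sub_exhaust O [set x] oO.
  exact: compact_set1.
by exists j; exact: Kj.
Qed.

End exhaustion.

Section L1loc_indicators.
Context {R : realType} {n : nat} (O : set 'rV[R]_n).
Local Notation leb := (@lebesgue R n).
Local Notation mleb A := (measurable (A : set (lebesgueType n))).
Local Open Scope ereal_scope.

Lemma L1distC K (f g : L1loc O) : L1dist K f g = L1dist K g f.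
Proof. by apply: eq_integral => x _; rewrite distrC. Qed.

Lemma L1dist_chi K A B (mA : mleb A) (mB : mleb B) : compact K ->
  L1dist K (chi O mA) (chi O mB) = leb (K `&` (A `+` B)).
Proof.
move=> cK; have mK := compact_lebesgue_measurable cK.
have mY : mleb (A `+` B) by exact: measurableY.
rewrite setIC -integral_indic//; apply: eq_integral => x _; congr (_%:E).
rewrite /= !indicE; case: (boolP (x \in A)); case: (boolP (x \in B));
  rewrite ?inE ?notin_setE => xB xA.
- by rewrite subrr normr0 memNset// => /setY_iff; tauto.
- by rewrite subr0 normr1 mem_set//; apply/setY_iff; tauto.
- by rewrite sub0r normrN normr1 mem_set//; apply/setY_iff; tauto.
- by rewrite subrr normr0 memNset// => /setY_iff; tauto.
Qed.

Lemma half_geometric_sum (c : R) (N : nat) : (0 <= c)%R ->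
  (\sum_(l < N) c / 2 ^+ l <= 2 * c)%R.
Proof.
move=> c0; suff -> : (\sum_(l < N) c / 2 ^+ l = 2 * c - 2 * c / 2 ^+ N)%R.
  by rewrite gerBl divr_ge0// ?exprn_ge0// mulr_ge0.
elim: N => [|N IH]; first by rewrite big_ord0 expr0 divr1 subrr.
by rewrite big_ord_recr/= IH exprS; field; rewrite expf_neq0.
Qed.

(** With summable errors the limit set can be written down, as the upper limit
    of the A j: a point where A j and F differ is a point where two consecutive
    terms differ, from the rank j on. *)
Lemma fast_cauchy_limsup (A : nat -> set 'rV[R]_n) (mA : forall j, mleb (A j))
    (c : R) : (0 <= c)%R ->
  (forall j, leb (exhaust O j `&` (A j `+` A j.+1)) <= (c / 2 ^+ j)%:E) ->
  exists F, mleb F /\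
    forall j, leb (exhaust O j `&` (A j `+` F)) <= (2 * (c / 2 ^+ j))%:E.
Proof.
move=> c0 HA; pose F := \bigcap_N \bigcup_(j in [set j | (N <= j)%N]) A j.
have mF : mleb F.
  by apply: bigcapT_measurable => N; apply: bigcup_measurable.
exists F; split => // j.
have mK l := compact_lebesgue_measurable (@exhaust_compact R n O l).
pose D l := exhaust O (j + l) `&` (A (j + l)%N `+` A (j + l).+1).
have mD l : mleb (D l) by apply: measurableI => //; exact: measurableY.
have sub : exhaust O j `&` (A j `+` F) `<=` \bigcup_l D l.
  move=> x [Kx /setY_iff nAF]; apply: contrapT => nD; apply: nAF.
  have step l : A (j + l)%N x <-> A (j + l).+1 x.
    apply: contrapT => nA; apply: nD; exists l => //; split.
      by apply: exhaustS Kx; rewrite leq_addr.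
    exact/setY_iff.
  have H l : A j x <-> A (j + l)%N x.
    by elim: l => [|l IH]; rewrite ?addn0// IH step addnS.
  split=> [Ajx N _|Fx].
    by exists (j + N)%N; rewrite /= ?leq_addl//; apply/(H N).
  have [l /= jl Alx] := Fx j I; apply/(H (l - j)%N).
  by rewrite subnKC.
apply: le_trans (measure_sigma_subadditive _ mD _ sub) _.
  by apply: measurableI => //; exact: measurableY.
apply: lime_le; first exact: is_cvg_nneseries.
apply: nearW => N; rewrite big_mkord.
apply: le_trans (_ : (\sum_(l < N) ((c / 2 ^+ j) / 2 ^+ l)%R%:E <= _)).
  apply: lee_sum => l _; apply: le_trans (HA _) _.
  by rewrite lee_fin exprD invfM mulrA.
rewrite sumEFin lee_fin; apply: half_geometric_sum.
by rewrite divr_ge0// exprn_ge0.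
Qed.

Lemma ultra_finite_cover (T : Type) (F : set_system T) (I : finType)
    (V : I -> set T) : UltraFilter F -> F (\bigcup_(i in [set: I]) V i) ->
  exists i, F (V i).
Proof.
move=> FU FV; apply: contrapT => nF.
have H i : F (~` V i).
  by have [FVi|//] := in_ultra_setVsetC (V i) FU; exfalso; apply: nF; exists i.
have FH : F (fun x => forall i, (~` V i) x) by apply: filter_forall.
have [x [[i _ Vx] nV]] := filter_ex (filterI FV FH).
exact: (nV i).
Qed.

(** An ultrafilter containing the closure contains, by finiteness of the codes,
    arbitrarily small sets {g | dist_K (chi A_k, g) < e}. Choosing K and e along
    the exhaustion yields a fast Cauchy sequence of sets A_(k_j), and the
    ultrafilter converges to the indicator of its limit. *)
Lemma L1loc_closure_compact (A : nat -> set 'rV[R]_n) (mA : forall k, mleb (A k)) :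
  open O ->
  (forall K (e : R), compact K -> K `<=` O -> (0 < e)%R ->
    exists (I : finType) (code : nat -> I), forall k l, code k = code l ->
      leb (K `&` (A k `+` A l)) < e%:E) ->
  compact (closure (range (fun k => chi O (mA k)))).
Proof.
move=> oO HA; rewrite compact_ultra => F FU FS.
pose f k := chi O (mA k).
have tb K (e : R) : compact K -> K `<=` O -> (0 < e)%R ->
    exists k, F [set g | L1dist K (f k) g < e%:E].
  move=> cK KO e0; have e20 : (0 < e / 2)%R by rewrite divr_gt0.
  have [I [code Hcode]] := HA K _ cK KO e20.
  pose V c := [set g | exists k, code k = c /\ L1dist K (f k) g < (e / 2)%:E].
  have [|c FV] := @ultra_finite_cover _ F I V FU.
    apply: filterS FS => g clg.
    have [_ [[k _ <-] gk]] : range f `&` [set h | L1dist K g h < (e / 2)%:E] !=set0.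
      by apply: clg; exists K, (e / 2)%R; split.
    by exists (code k) => //; exists k; split => //; rewrite L1distC.
  have [_ [k [kc _]]] := filter_ex FV.
  exists k; apply: filterS FV => g [l [lc lg]] /=.
  apply: le_lt_trans (L1dist_triangle _ (f l) _ KO cK) _.
  rewrite (splitr e) EFinD lteD// L1dist_chi//.
  by apply: Hcode; rewrite kc.
pose e j : R := (1 / 2 ^+ j)%R.
have e0 j : (0 < e j)%R by rewrite divr_gt0// exprn_gt0.
have cK (j : nat) := @exhaust_compact R n O j.
have KO (j : nat) := @exhaust_sub R n O j.
have /choice[k Hk] j := tb _ _ (cK j) (KO j) (e0 j).
have [j|B [mB HB]] := @fast_cauchy_limsup (fun j => A (k j)) (fun j => mA (k j)) 2 (ler0n _ _).
  have [g [g1 g2]] := filter_ex (filterI (Hk j) (Hk j.+1)).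
  rewrite -L1dist_chi//; apply: le_trans (L1dist_triangle _ g _ (KO j) (cK j)) _.
  have g2' : L1dist (exhaust O j) g (f (k j.+1)) <= (e j)%:E.
    rewrite L1distC.
    apply: (@le_trans _ _ (L1dist (exhaust O j.+1) (f (k j.+1)) g)).
      by apply: L1dist_subset => //; exact: exhaustS.
    apply: le_trans (ltW g2) _; rewrite lee_fin ler_pM2l// lef_pV2 ?posrE ?exprn_gt0//.
    by rewrite exprS ler_peMl ?exprn_ge0// ler1n.
  apply: le_trans (leeD (ltW g1) g2') _.
  by rewrite -EFinD lee_fin /e -mulrDl.
have cv : F --> chi O mB.
  move=> U [K [d [KO' cK' d0 KU]]]; rewrite nbhs_filterE.
  have [j0 Kj0] := sub_exhaust oO cK' KO'.
  have [j [jj0 jd]] : exists j, (j0 <= j)%N /\ (5 / 2 ^+ j < d)%R.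
    exists (maxn j0 (Num.trunc (5 / d)).+1); split; first exact: leq_maxl.
    set j := maxn _ _; rewrite ltr_pdivrMr ?exprn_gt0// -ltr_pdivrMl// mulrC.
    apply: lt_trans (truncnS_gt _) _; rewrite -natrX ltr_nat.
    by apply: leq_ltn_trans (ltn_expl j (ltnSn 1)); rewrite leq_maxr.
  apply: filterS (Hk j) => g gj; apply: KU => /=.
  have Kj : K `<=` exhaust O j by apply: subset_trans Kj0 _; exact: exhaustS.
  apply: (@le_lt_trans _ _ (L1dist (exhaust O j) (chi O mB) g)).
    exact: L1dist_subset.
  apply: le_lt_trans (L1dist_triangle _ (f (k j)) _ (KO j) (cK j)) _.
  rewrite L1distC L1dist_chi//.
  apply: le_lt_trans (leeD (HB j) (ltW gj)) _.
  rewrite -EFinD lte_fin; apply: le_lt_trans jd.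
  by rewrite /e le_eqVlt; apply/orP; left; apply/eqP; ring.
exists (chi O mB); split => //.
have -> : closure (range f) = closure (closure (range f)).
  exact/closure_id/closed_closure.
by move=> U pU; exact: filter_ex (filterI FS (cv U pU)).
Qed.

End L1loc_indicators.

(** * Comparing two sets by majority vote *)

Section majority.
Context {R : realType} {n : nat}.
Local Notation mu := (@borel_lebesgue R n).
Local Notation B0 r := (ball (0%R : 'rV[R]_n) r).
Local Open Scope ereal_scope.

(** By Fubini its integral over x in K is the integral of the jump volumes over z in
    B_r; unlike these it is attached to a point, where two sets can be compared. *)
Definition local_jump (C : set 'rV[R]_n) (r : R) (x : 'rV[R]_n) : \bar R :=
  mu (B0 r `&` [set z | ~ (C x <-> C (x + z)%R)]).

Lemma measurable_local_jump_graph (K C : set 'rV[R]_n) r :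
  measurable K -> measurable C ->
  measurable [set p : 'rV[R]_n * 'rV[R]_n |
    K p.1 /\ (B0 r p.2 /\ ~ (C p.1 <-> C (p.1 + p.2)%R))].
Proof.
move=> mK mC.
have -> : [set p : 'rV[R]_n * 'rV[R]_n |
    K p.1 /\ (B0 r p.2 /\ ~ (C p.1 <-> C (p.1 + p.2)%R))] =
    (K `*` B0 r) `&` ((C `*` setT) `+` ((fun p => (p.1 + p.2)%R) @^-1` C)).
  apply/seteqP; split=> p.
    by move=> [? [? H]]; split => //; apply/setY_iff => /=; tauto.
  by move=> [[? ?] /setY_iff/= H]; split => //; split => //; tauto.
apply: measurableI; first exact: measurableX (measurable_ball_rV _ _).
apply: measurableY; first exact: measurableX.
rewrite -[X in measurable X]setTI; exact: measurable_rV_add.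
Qed.

Lemma local_jump_xsection (K C : set 'rV[R]_n) r x : K x ->
  local_jump C r x = mu (xsection [set p : 'rV[R]_n * 'rV[R]_n |
    K p.1 /\ (B0 r p.2 /\ ~ (C p.1 <-> C (p.1 + p.2)%R))] x).
Proof.
move=> Kx; rewrite /local_jump; congr (mu _); apply/seteqP; split => z; rewrite xsectionE/= => H.
  by split.
by case: H.
Qed.

Lemma measurable_local_jump_set (C : set 'rV[R]_n) r (x : 'rV[R]_n) : measurable C ->
  measurable (B0 r `&` [set z | ~ (C x <-> C (x + z)%R)]).
Proof.
move=> mC; have := measurable_xsection x (measurable_local_jump_graph r measurableT mC).
by congr measurable; apply/seteqP; split => z; rewrite xsectionE/= => H;
  [case: H|split].
Qed.

Lemma measurable_local_jump C r : measurable C ->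
  measurable_fun setT (local_jump C r).
Proof.
move=> mC; have := measurable_fun_xsection mu
  (measurable_local_jump_graph r measurableT mC).
by congr measurable_fun; apply/funext => x; rewrite (@local_jump_xsection setT).
Qed.

Lemma integral_local_jump (K C : set 'rV[R]_n) r : measurable K -> measurable C ->
  \int[mu]_(x in K) local_jump C r x = \int[mu]_(z in B0 r) jumpvol K C z.
Proof.
move=> mK mC; have mS := measurable_local_jump_graph r mK mC.
set S := [set p | _] in mS.
pose f p : \bar R := (\1_S p)%:E.
have mf : measurable_fun setT f by apply/measurable_EFinP; exact: measurable_indic.
have f0 p : 0 <= f p by rewrite lee_fin.
transitivity (\int[mu]_x \int[mu]_z f (x, z)).
  rewrite integral_mkcond; apply: eq_integral => x _; rewrite patchE.
  rewrite (_ : (fun z => f (x, z)) = fun z => (\1_(xsection S x) z)%:E); last first.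
    by apply/funext => z; rewrite /f !indicE mem_xsection.
  rewrite integral_indic//; last exact: measurable_xsection.
  rewrite setIT; case: ifPn => [|]; rewrite ?notin_setE ?inE => Kx.
    exact: local_jump_xsection.
  rewrite (_ : xsection S x = set0) ?measure0// -subset0 => z.
  by rewrite xsectionE/= => -[].
rewrite (fubini_tonelli f mf f0) [RHS]integral_mkcond; apply: eq_integral => z _.
rewrite (_ : (fun x => f (x, z)) = fun x => (\1_(ysection S z) x)%:E); last first.
  by apply/funext => x; rewrite /f !indicE mem_ysection.
rewrite integral_indic//; last exact: measurable_ysection.
rewrite setIT patchE; case: ifPn => [|]; rewrite ?notin_setE ?inE => Bz.
  rewrite /jumpvol; congr (mu _); apply/seteqP; split => x; rewrite ysectionE/=.
    by move=> [Kx [_ H]]; split => //; apply/setY_iff.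
  by move=> [Kx /setY_iff H].
rewrite (_ : ysection S z = set0) ?measure0// -subset0 => x.
by rewrite ysectionE/= => -[_ []].
Qed.

(** Let x be a point where C and D differ, in the ball around a. If both sets fill
    half of that ball, the one not containing x changes between x and half of the
    ball, which lies in x + B_(2 rho); if neither does, the same holds for the
    set containing x and its complement. Thus on C `+` D the sum of the two local jumps is at
    least half the measure of the ball. *)
Lemma majority_vote (I : finType) (c : I -> 'rV[R]_n) (rho : R)
    (K C D : set 'rV[R]_n) : (0 < rho)%R ->
  measurable K -> measurable C -> measurable D ->
  (forall x, K x -> exists a, ball (c a) rho x) ->
  (forall a, (mu (C `&` ball (c a) rho) < ((2 * rho) ^+ n / 2)%:E) =
             (mu (D `&` ball (c a) rho) < ((2 * rho) ^+ n / 2)%:E)) ->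
  ((2 * rho) ^+ n / 2)%:E * mu (K `&` (C `+` D)) <=
  \int[mu]_(z in B0 (2 * rho)) jumpvol K C z +
  \int[mu]_(z in B0 (2 * rho)) jumpvol K D z.
Proof.
move=> rho0 mK mC mD Kc code.
set h : R := ((2 * rho) ^+ n / 2)%R in code *.
have h0 : (0 < h)%R by rewrite divr_gt0// exprn_gt0// mulr_gt0.
pose g := local_jump C (2 * rho); pose g' := local_jump D (2 * rho).
have mg : measurable_fun setT g by exact: measurable_local_jump.
have mg' : measurable_fun setT g' by exact: measurable_local_jump.
have g0 x : 0 <= g x by exact: measure_ge0.
have g0' x : 0 <= g' x by exact: measure_ge0.
have mY : measurable (K `&` (C `+` D)) by apply: measurableI => //; exact: measurableY.
(* ball (c a) rho lies in x + B_(2 rho): every y in it is a displacement from x *)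
have key (X Y : set 'rV[R]_n) a x : measurable X -> measurable Y ->
    ball (c a) rho x -> (forall y, Y y -> ~ (X x <-> X y)) ->
    mu (Y `&` ball (c a) rho) <= local_jump X (2 * rho) x.
  move=> mX mY' ax XY.
  rewrite -(borel_lebesgue_translate x); last by apply: measurableI => //; exact: measurable_ball_rV.
  apply: le_measure; rewrite ?inE.
  - apply: (@measurable_translate _ _ x); apply: measurableI => //; exact: measurable_ball_rV.
  - exact: measurable_local_jump_set.
  move=> z [Yz cz]; split; last by have := XY _ Yz; rewrite addrC.
  have : ball x (rho + rho) (z + x)%R by exact: ball_triangle (ball_sym ax) cz.
  rewrite mx_norm_ball /ball_/= opprD addrCA subrr addr0 normrN => H.
  by rewrite sub0r normrN (_ : 2 * rho = rho + rho)%R//; ring.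
have half a X x : measurable X -> ball (c a) rho x ->
    (mu (X `&` ball (c a) rho) < h%:E -> X x -> h%:E <= local_jump X (2 * rho) x) /\
    (h%:E <= mu (X `&` ball (c a) rho) -> ~ X x -> h%:E <= local_jump X (2 * rho) x).
  move=> mX ax; split=> [Xh Xx|Xh nXx]; last first.
    by apply: le_trans Xh _; apply: key => // y Xy; tauto.
  apply: le_trans (_ : mu (~` X `&` ball (c a) rho) <= _); last first.
    by apply: key => //; [exact: measurableC|move=> y /= nXy; tauto].
  have mB := measurable_ball_rV (c a) rho.
  have := borel_lebesgue_ball (c a) rho0.
  have -> : ((2 * rho) ^+ n = h + h)%R by rewrite /h -splitr.
  rewrite (measureDI mu mB mX) setDE (setIC _ (~` X)) (setIC _ X) => e.
  rewrite leNgt; apply/negP => Hlt; have := lteD Hlt Xh.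
  by rewrite e EFinD ltxx.
apply: (@le_trans _ _ (\int[mu]_(x in K `&` (C `+` D)) (g x + g' x))).
  rewrite -integral_cst//; apply: ge0_le_integral => //.
  - by move=> x _; rewrite lee_fin ltW.
  - by apply: measurable_funTS; exact: emeasurable_funD.
  move=> x [/Kc[a ax] CD].
  have [C1 C2] := half a C x mC ax; have [D1 D2] := half a D x mD ax.
  have H : h%:E <= g x \/ h%:E <= g' x.
    have := code a; have [Ch|Ch] := ltP (mu (C `&` ball (c a) rho)) h%:E => /esym Dh.
      case: CD => -[? ?]; [left; exact: C1|right; exact: D1].
    have {}Dh : h%:E <= mu (D `&` ball (c a) rho) by rewrite leNgt Dh.
    case: CD => -[? ?]; [right; exact: D2|left; exact: C2].
  by case: H => H; [rewrite (le_trans H)// leeDl|rewrite (le_trans H)// leeDr].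
rewrite ge0_integralD//; [|exact: measurable_funTS|exact: measurable_funTS].
rewrite -!integral_local_jump//; apply: leeD; apply: ge0_subset_integral => //.
- exact: measurable_funTS.
- exact: measurable_funTS.
Qed.

End majority.

(** * Precompactness of the sequence of partitions *)

Section compactness.
Context {R : realType} {n : nat}.
Local Notation mu := (@borel_lebesgue R n).
Local Notation leb := (@lebesgue R n).

Lemma compact_finite_net (K : set 'rV[R]_n) (rho : R) : compact K -> 0 < rho ->
  exists (I : finType) (c : I -> 'rV[R]_n),
    forall x, K x -> exists a, ball (c a) rho x.
Proof.
move=> cK rho0; move: cK; rewrite compact_cover => cK.
have [|x Kx|D _ KD] := cK _ K (fun x : 'rV[R]_n => ball x rho).
- by move=> x _; exact: ball_open.
- by exists x => //; exact: ballxx.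
exists (seq_sub (finmap.enum_fset D)), (fun a => ssval a) => x /KD[y /= yD xy].
by exists (SeqSub yD).
Qed.

(** The code of k is its majority pattern on a net of K of mesh rho; the finitely
    many small k, for which s_k may be far from 1/2, are given a code of their
    own. By [majority_vote] and the average jump bound, two chambers with the
    same code differ on K by a multiple of (2 rho)^(2 s_k), which is small
    once s_k > 1/4. *)
Lemma totally_bounded_chambers m (Omega : set 'rV[R]_n) (sigma : 'M[R]_m)
    (s : nat -> R) (E : nat -> mpartition m [set: 'rV[R]_n]) (i : 'I_m) :
  (0 < n)%N ->
  open Omega -> surface_tensions sigma ->
  (forall k, 0 < s k < 1 / 2) -> s k @[k --> \oo] --> (1 / 2 : R) ->
  locally_bounded_energy Omega sigma s E ->
  forall K (e : R), compact K -> K `<=` Omega -> 0 < e ->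
    exists (I : finType) (code : nat -> I), forall k l, code k = code l ->
      (leb (K `&` (E k i `+` E l i)) < e%:E)%E.
Proof.
move=> n0 oO hsig hs slim Eb K e cK KO e0.
have [r0 [M [r00 M0 HEM]]] := uniform_jump_bounds n0 oO cK KO hsig hs Eb.
have /choice[C HC] (k : nat) := HEM k i.
have [k1 _ Hk1] : \forall k \near \oo, 1 / 4 < s k by apply: cvgr_gt slim _ _; lra.
(* with 2 rho = tau^2 and s_k > 1/4, (2 rho)^(2 s_k) <= tau *)
pose tau := Num.min (Num.min 1 r0) (e / (8 * M + 8)).
have D0 : 0 < 8 * M + 8 by lra.
have tau0 : 0 < tau by rewrite !lt_min ltr01 r00 divr_gt0.
have [tau1 taur] : tau <= 1 /\ tau <= r0 by split; rewrite /tau !ge_min lexx ?orbT.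
have taue : 4 * M * tau < e.
  have : tau <= e / (8 * M + 8) by rewrite /tau !ge_min lexx ?orbT.
  rewrite ler_pdivlMr// => H.
  have : 0 <= M * tau by rewrite mulr_ge0// ltW.
  by lra.
pose rho := tau ^+ 2 / 2.
have rhoE : 2 * rho = tau ^+ 2 by rewrite /rho; field.
have rho0 : 0 < rho by rewrite divr_gt0// exprn_gt0.
have rhor : 0 < 2 * rho <= r0.
  rewrite rhoE exprn_gt0//= (le_trans _ taur)// expr2 ler_piMr//; exact: ltW.
have [I [c Kc]] := compact_finite_net cK rho0.
pose half : R := (2 * rho) ^+ n / 2.
have half0 : 0 < half by rewrite divr_gt0// exprn_gt0// mulr_gt0.
pose vote k := [ffun a : I => (mu (C k `&` ball (c a) rho) < half%:E)%E].
pose code k : ('I_k1.+1 + {ffun I -> bool})%type :=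
  if (k < k1)%N then inl (inord k) else inr (vote k).
exists ('I_k1.+1 + {ffun I -> bool})%type, code => k l; rewrite /code.
have [kk1|kk1] := ltnP k k1; have [lk1|lk1] := ltnP l k1 => //.
  move=> [/(congr1 val)]; rewrite /= !inordK ?ltnS// 1?ltnW// => <-.
  by rewrite setYK setI0 measure0 lte_fin.
move=> [kl].
have [mCk aek Xk _] := HC k; have [mCl ael Xl _] := HC l.
have mK := compact_measurable_rV cK.
have mE k' := partition_measurable (chamberP (E k')) i.
have mYC : measurable (K `&` (C k `+` C l)).
  by apply: measurableI => //; exact: measurableY.
rewrite (@lebesgue_ae_eq _ _ _ (K `&` (C k `+` C l))); last 3 first.
- by apply: measurableI; [exact: compact_lebesgue_measurable|exact: measurableY].
- exact: borel_lebesgue_measurable.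
- apply: filterS2 aek ael => x xk xl.
  by split=> -[Kx /setY_iff H]; split => //; apply/setY_iff; tauto.
rewrite lebesgueE//.
have codeE a : (mu (C k `&` ball (c a) rho) < half%:E)%E =
               (mu (C l `&` ball (c a) rho) < half%:E)%E.
  by have /ffunP/(_ a) := kl; rewrite !ffunE.
have := majority_vote rho0 mK mCk mCl Kc codeE; rewrite -/half.
have small k' : (k1 <= k')%N -> (M * (2 * rho) `^ (n%:R + 2 * s k') <= M * (2 * half * tau)).
  move=> k1k'; rewrite ler_wpM2l//.
  have r2 : 2 * rho != 0 by rewrite gt_eqF// mulr_gt0.
  rewrite powRD; last by rewrite r2 implybT.
  rewrite powR_mulrn; last by rewrite mulr_ge0// ltW.
  rewrite (_ : 2 * half = (2 * rho) ^+ n); last by rewrite /half; field.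
  have rn0 : 0 <= (2 * rho) ^+ n by rewrite exprn_ge0// mulr_ge0// ltW.
  apply: (ler_wpM2l rn0).
  have -> : tau = (2 * rho) `^ (2^-1).
    by rewrite rhoE powR12_sqrt ?sqr_ge0// sqrtr_sqr ger0_norm// ltW.
  apply: ger_powR; last by have := Hk1 k' k1k'; lra.
  by rewrite rhoE exprn_gt0//= exprn_ile1// ltW.
move=> /le_trans/(_ (leeD (Xk _ rhor) (Xl _ rhor))).
rewrite -EFinD -lee_pdivlMl// => /le_lt_trans; apply.
rewrite -EFinM lte_fin; apply: le_lt_trans taue.
rewrite ler_pdivrMl//; apply: le_trans (lerD (small _ kk1) (small _ lk1)) _.
by rewrite le_eqVlt; apply/orP; left; apply/eqP; ring.
Qed.

Lemma ptws_closed_box (I : eqType) (T : topologicalType) (A : I -> set T) :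
  (forall i, closed (A i)) ->
  closed ([set f | forall i, A i (f i)] : set {ptws I -> T}).
Proof.
move=> cA.
rewrite (_ : mkset _ = \bigcap_(i in [set: I])
    ((fun f : {ptws I -> T} => f i) @^-1` A i)).
  apply: closed_bigI => i _.
  have cp : continuous (@proj I (fun=> T) i : {ptws I -> T} -> T).
    exact: (@proj_continuous I (fun=> T) i).
  by move/continuous_closedP : cp; exact.
by apply/seteqP; split => f /= H i; [move=> _|]; exact: H.
Qed.

(** Each chamber stays in a compact set of the local L1 space; a product of
    compact sets is compact. *)
Lemma precompact_chambers m (Omega : set 'rV[R]_n) (sigma : 'M[R]_m)
    (s : nat -> R) (E : nat -> mpartition m [set: 'rV[R]_n]) :
  (0 < n)%N ->
  open Omega -> surface_tensions sigma ->
  (forall k, 0 < s k < 1 / 2) -> s k @[k --> \oo] --> (1 / 2 : R) ->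
  locally_bounded_energy Omega sigma s E ->
  precompact (range (fun k => chi_partition Omega (E k))).
Proof.
move=> n0 oO hsig hs slim Eb.
pose A i := closure (range (fun k =>
  chi Omega (partition_measurable (chamberP (E k)) i))).
exists ([set f | forall i, A i (f i)] : set {ptws 'I_m -> L1loc Omega}).
  by move=> _ [k _ <-] i; apply: subset_closure; exists k.
split; last by apply: ptws_closed_box => i; exact: closed_closure.
apply: tychonoff => i; apply: L1loc_closure_compact => // K e cK KO e0.
exact: (totally_bounded_chambers i n0 oO hsig hs slim Eb cK KO e0).
Qed.

End compactness.

(** * Regularity of compactly supported test fields *)

Section test_field_regularity.
Context {R : realType} {n : nat}.
Local Notation basis i := (delta_mx ord0 i : 'rV[R]_n).

Lemma continuous_measurable_rV (f : 'rV[R]_n -> R) : continuous f ->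
  measurable_fun setT f.
Proof.
move=> cf; apply: (measurability _ (measurable_realfun.RGenOInfty.measurableE R)).
move=> _ [_ [x ->] <-]; rewrite setTI; apply: open_measurable_rV.
by apply: open_comp => // y _; exact: cf.
Qed.

Lemma basis_norm (i : 'I_n) : `|basis i| <= 1.
Proof.
rewrite [leLHS]/Num.norm/= mx_normrE; apply/bigmax_leP; split => // -[a b] _ /=.
by rewrite mxE ord1 eqxx/=; case: (b == i); rewrite ?normr1 ?normr0.
Qed.

Lemma directional_difference_quotient (phi : 'rV[R]_n -> 'rV[R]_n) (i j : 'I_n) x :
  derivable phi x (basis j) ->
  h^-1 * (phi (x + h *: basis j) ord0 i - phi x ord0 i) @[h --> 0^'] -->
  ('D_(basis j) phi x) ord0 i.
Proof.
move=> dphi; have := @cvg_comp _ _ _ _ (fun M : 'rV[R]_n => M ord0 i) _ _ _ dphi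
  (@coord_continuous _ _ _ _ _ _).
apply: cvg_trans; apply: near_eq_cvg; near=> h.
by rewrite /= !mxE (addrC x).
Unshelve. all: by end_near. Qed.

Lemma directional_derivative_is_derive (phi : 'rV[R]_n -> 'rV[R]_n) (i j : 'I_n)
    (x : 'rV[R]_n) (t : R) :
  (forall y, derivable phi y (basis j)) ->
  is_derive t 1 (fun u : R => phi (x + u *: basis j) ord0 i)
    (('D_(basis j) phi (x + t *: basis j)) ord0 i).
Proof.
move=> dphi.
have := directional_difference_quotient (i := i) (dphi (x + t *: basis j)).
set l := ('D_(basis j) phi _) ord0 i => cl.
have cl' : h^-1 *: (phi (x + (h *: 1 + t) *: basis j) ord0 i -
    phi (x + t *: basis j) ord0 i) @[h --> 0^'] --> l.
  apply: cvg_trans cl; apply: near_eq_cvg; near=> h.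
  by rewrite [h *: 1]mulr1 scalerDl addrA [in RHS]addrAC.
apply: DeriveDef.
  by apply/cvg_ex; exists l.
exact/cvg_lim.
Unshelve. all: by end_near. Qed.

(** Mean value inequality along the line through x of direction [basis j]. *)
Lemma directional_lipschitz (phi : 'rV[R]_n -> 'rV[R]_n) (i j : 'I_n) (B : R) :
  (forall y, derivable phi y (basis j)) ->
  (forall y, `|('D_(basis j) phi y) ord0 i| <= B) ->
  forall x t, `|phi (x + t *: basis j) ord0 i - phi x ord0 i| <= B * `|t|.
Proof.
move=> dphi HB x t.
pose g : R -> R := fun u => phi (x + u *: basis j) ord0 i.
pose dg : R -> R := fun u => ('D_(basis j) phi (x + u *: basis j)) ord0 i.
have Hd (u : R) : is_derive u 1 g (dg u) by exact: directional_derivative_is_derive.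
have cg : continuous g.
  by move=> u; apply: differentiable_continuous; apply/derivable1_diffP; case: (Hd u).
have H a b : a <= b -> `|g b - g a| <= B * `|b - a|.
  move=> ab; have [c _ ->] := @MVT_segment R g dg a b ab (fun u _ => Hd u)
    (continuous_subspaceT cg).
  by rewrite normrM ler_wpM2r//; exact: HB.
have -> : phi x ord0 i = g 0 by rewrite /g scale0r addr0.
rewrite -/(g t); have [t0|t0] := leP 0 t.
  by have := H _ _ t0; rewrite subr0.
by have := H _ _ (ltW t0); rewrite sub0r normrN distrC.
Qed.

(** [C1] only speaks of partial derivatives; moving along one coordinate at a
    time recovers a Lipschitz bound, hence the continuity of the field. *)
Lemma partials_bounded_lipschitz (phi : 'rV[R]_n -> 'rV[R]_n) (i : 'I_n) (B : R) :
  (forall j y, derivable phi y (basis j)) ->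
  (forall j y, `|('D_(basis j) phi y) ord0 i| <= B) ->
  forall x h, `|phi (x + h) ord0 i - phi x ord0 i| <= n%:R * B * `|h|.
Proof.
move=> dphi HB x h.
have H (s : seq 'I_n) :
    `|phi (x + \sum_(j <- s) h ord0 j *: basis j) ord0 i - phi x ord0 i| <=
    (size s)%:R * B * `|h|.
  elim: s => [|j s IH]; first by rewrite big_nil addr0 subrr normr0 !mul0r.
  rewrite big_cons /= -natr1 mulrDl mulrDl mul1r.
  rewrite [X in phi (x + X)]addrC addrA.
  set y := x + _ in IH *.
  apply: le_trans (ler_distD (phi y ord0 i) _ _) _.
  rewrite [leRHS]addrC; apply: lerD => //.
  apply: le_trans (directional_lipschitz (dphi j) (HB j) y _) _.
  rewrite ler_wpM2l//; first exact: le_trans (normr_ge0 _) (HB j 0).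
  exact: rV_coord_le.
have := H (index_enum 'I_n); rewrite -row_sum_delta.
by rewrite -[X in X%:R]/(size (Finite.enum 'I_n)) -enumT size_enum_ord.
Qed.

Lemma coord_le_enorm (x : 'rV[R]_n) i : `|x ord0 i| <= enorm x.
Proof.
rewrite -sqrtr_sqr /enorm ler_wsqrtr// (bigD1 i)//= lerDl.
by apply: sumr_ge0 => j _; exact: sqr_ge0.
Qed.

Lemma derive_outside_support (phi : 'rV[R]_n -> 'rV[R]_n) (K : set 'rV[R]_n) v x :
  compact K -> (forall y, ~ K y -> phi y = 0) -> ~ K x -> 'D_v phi x = 0.
Proof.
move=> cK phi0 nKx; rewrite -(derive_cst (0 : 'rV[R]_n) x v).
apply: near_eq_derive.
have oK : open (~` K).
  by rewrite openC; apply: compact_closed => //; exact: norm_hausdorff.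
have := open_nbhs_nbhs (conj oK nKx); apply: filterS => y /= nKy.
exact: phi0.
Qed.

Lemma C1_partials_bounded (phi : 'rV[R]_n -> 'rV[R]_n) (K : set 'rV[R]_n) (i : 'I_n) :
  C1 phi -> compact K -> (forall y, ~ K y -> phi y = 0) ->
  exists B : R, forall j y, `|('D_(basis j) phi y) ord0 i| <= B.
Proof.
move=> C1phi cK phi0.
have HB (j : 'I_n) : exists B : R, 0 <= B /\ forall y, `|('D_(basis j) phi y) ord0 i| <= B.
  have cD : continuous (fun y => ('D_(basis j) phi y) ord0 i).
    move=> y; apply: (@continuous_comp _ _ _ (fun y => 'D_(basis j) phi y)
      (fun M : 'rV[R]_n => M ord0 i)); last exact: coord_continuous.
    by have [_] := C1phi j; exact.
  have := continuous_compact (continuous_subspaceT cD) cK.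
  move=> /compact_bounded[M [_ /(_ (M + 1))]]; rewrite ltrDl => /(_ ltr01) HM.
  exists (Num.max 0 (M + 1)); split; first by rewrite le_max lexx.
  move=> y; have [Ky|nKy] := pselect (K y).
    by rewrite le_max HM ?orbT//; exists y.
  by rewrite (derive_outside_support _ cK phi0 nKy) mxE normr0 le_max lexx.
have /choice[B HB'] := HB; exists (\sum_j B j) => j y.
apply: le_trans ((HB' j).2 y) _; rewrite (bigD1 j)//= lerDl.
by apply: sumr_ge0 => l _; exact: (HB' l).1.
Qed.

Lemma C1_coord_continuous (phi : 'rV[R]_n -> 'rV[R]_n) (K : set 'rV[R]_n) (i : 'I_n) :
  C1 phi -> compact K -> (forall y, ~ K y -> phi y = 0) ->
  continuous (fun x => phi x ord0 i).
Proof.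
move=> C1phi cK phi0 x.
have [B HB] := C1_partials_bounded i C1phi cK phi0.
have L := partials_bounded_lipschitz (fun j => (C1phi j).1) HB.
pose C := Num.max 1 (n%:R * B).
have C0 : 0 < C by rewrite lt_max ltr01.
move=> U /nbhs_ballP[e /= e0 eU]; apply/(@nbhs_ballP _ _ x).
exists (e / C) => /=; first by rewrite divr_gt0.
move=> y; rewrite mx_norm_ball /ball_/= distrC => xy; apply: eU.
rewrite /ball/= distrC; have := L x (y - x); rewrite subrKC => /le_lt_trans; apply.
apply: le_lt_trans (_ : C * `|y - x| < e).
  by rewrite ler_wpM2r// le_max lexx orbT.
by rewrite -ltr_pdivlMl// mulrC.
Qed.

End test_field_regularity.

(** * Flux of a partial derivative through a set *)

Section flux.
Context {R : realType} {n : nat}.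
Local Notation mu := (@borel_lebesgue R n).
Local Notation leb := (@lebesgue R n).
Local Notation mleb A := (measurable (A : set (lebesgueType n))).

Lemma integral_translate (h : 'rV[R]_n) (f : 'rV[R]_n -> \bar R) :
  measurable_fun setT f ->
  (\int[mu]_x f (x + h)%R = \int[mu]_x f x)%E.
Proof.
move=> mf; rewrite integralE [RHS]integralE; congr (_ - _)%E.
  rewrite -(ge0_integral_translate h (measurable_funepos mf) (fun x => funepos_ge0 f x)).
  by apply: eq_integral => x _; rewrite !funeposE.
rewrite -(ge0_integral_translate h (measurable_funeneg mf) (fun x => funeneg_ge0 f x)).
  by apply: eq_integral => x _; rewrite !funenegE.
Qed.

Lemma integral_lebesgue (A B : set 'rV[R]_n) (f : 'rV[R]_n -> \bar R) :
  mleb A -> measurable B -> {ae leb, forall x, A x <-> B x} ->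
  measurable_fun setT f ->
  (\int[leb]_(x in A) f x = \int[mu]_(x in B) f x)%E.
Proof.
move=> mA mB AB mf; rewrite integralE [RHS]integralE; congr (_ - _)%E.
  exact: ge0_integral_lebesgue (measurable_funepos mf) _.
exact: ge0_integral_lebesgue (measurable_funeneg mf) _.
Qed.

Lemma compact_borel_lebesgue_fin (K : set 'rV[R]_n) : compact K -> (mu K < +oo)%E.
Proof.
move=> cK; rewrite -lebesgueE; first exact: compact_lebesgue_fin.
exact: compact_measurable_rV.
Qed.

Lemma nbd_borel_lebesgue_fin (K : set 'rV[R]_n) r : compact K -> (mu (nbd K r) < +oo)%E.
Proof.
move=> cK; have [M [_ HM]] := bounded_nbd r cK.
pose N := Num.max 1 (M + 1 + 1); have N0 : 0 < N by rewrite lt_max ltr01.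
apply: (@le_lt_trans _ _ (mu (ball (0 : 'rV[R]_n) N))).
  apply: le_measure; rewrite ?inE.
  - by apply: open_measurable_rV; exact: nbd_open.
  - exact: measurable_ball_rV.
  move=> x Kx; rewrite mx_norm_ball /ball_/= sub0r normrN.
  apply: (@le_lt_trans _ _ (M + 1)); last by rewrite lt_max ltrDl ltr01 orbT.
  by apply: HM => //; rewrite ltrDl.
by rewrite borel_lebesgue_ball// ltry.
Qed.

Lemma integrable_bounded_support (f : 'rV[R]_n -> R) (B : R) (W : set 'rV[R]_n) :
  measurable_fun setT f -> measurable W -> (mu W < +oo)%E -> 0 <= B ->
  (forall x, `|f x| <= B * \1_W x) ->
  mu.-integrable setT (EFin \o f).
Proof.
move=> mf mW Woo B0 fB; apply/integrableP; split; first exact/measurable_EFinP.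
have mW1 : measurable_fun setT (fun x => B * \1_W x : R).
  by apply: measurable_funM => //; exact: measurable_indic.
apply: (@le_lt_trans _ _ (\int[mu]_x (B * \1_W x)%:E)%E).
  apply: ge0_le_integral => //.
  - by apply: measurableT_comp => //; exact/measurable_EFinP.
  - exact/measurable_EFinP.
  - by move=> x _; rewrite /= lee_fin.
under eq_integral do rewrite EFinM.
rewrite ge0_integralZl//.
- by rewrite integral_indic// setIT lte_mul_pinfty ?lee_fin.
- by apply/measurable_EFinP; exact: measurable_indic.
Qed.

(** The difference quotients of psi have integral over F equal, after translating,
    to the integral of psi times the difference quotient of the indicator of F.
    As |psi| <= 1 and psi vanishes outside K, this is at most |K `&` (F `+` (F - h))| / t
    with |h| <= t, hence at most L. Dominated convergence, the dominating function
    being B on a bounded neighborhood of K, passes to the limit t -> 0. *)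
Lemma partial_derivative_flux (F K : set 'rV[R]_n) (psi dpsi : 'rV[R]_n -> R)
    (e : 'rV[R]_n) (B L d : R) :
  measurable F -> compact K -> 0 <= B -> 0 < d -> `|e| <= 1 ->
  measurable_fun setT psi -> measurable_fun setT dpsi ->
  (forall x, `|psi x| <= 1) -> (forall x, ~ K x -> psi x = 0) ->
  (forall x t, `|psi (x + t *: e) - psi x| <= B * `|t|) ->
  (forall x, t^-1 * (psi (x + t *: e) - psi x) @[t --> 0^'] --> dpsi x) ->
  (forall t, 0 < t < d -> (jumpvol K F (- (t *: e)) <= (L * t)%:E)%E) ->
  mu.-integrable setT (fun x => (dpsi x * \1_F x)%:E) /\
  (\int[mu]_x (dpsi x * \1_F x)%:E <= L%:E)%E.
Proof.
move=> mF cK B0 d0 e1 mpsi mdpsi psi1 psi0 lip dq HL.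
have mK := compact_measurable_rV cK.
(* t k <= c <= 1 keeps the support of psi (_ + t k *: e) inside nbd K 2 *)
pose c := Num.min 1 d / 2.
have [c0 cd c1] : [/\ 0 < c, c < d & c <= 1].
  have m0 : 0 < Num.min 1 d by rewrite lt_min ltr01.
  have : Num.min 1 d <= d by rewrite ge_min lexx orbT.
  have : Num.min 1 d <= 1 by rewrite ge_min lexx.
  by rewrite /c; split; lra.
pose t (k : nat) : R := c * k.+1%:R^-1.
have t0 k : 0 < t k by rewrite mulr_gt0// invr_gt0.
have tc k : t k <= c by rewrite /t ler_piMr ?(ltW c0)// invf_le1// ler1n.
have cvt : t k @[k --> \oo] --> 0^'.
  have : t k @[k --> \oo] --> (0 : R).
    by rewrite -(mulr0 c); apply: cvgM; [exact: cvg_cst|exact: cvg_harmonic].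
  move=> ct A A0.
  have H : \forall k \near \oo, t k != 0 -> A (t k) := ct _ A0.
  suff : \forall k \near \oo, A (t k) by [].
  by apply: filterS H => k; apply; rewrite gt_eqF.
pose W := nbd K 2.
have mW : measurable W by apply: open_measurable_rV; exact: nbd_open.
have Woo : (mu W < +oo)%E by exact: nbd_borel_lebesgue_fin.
have KW : K `<=` W by exact: sub_nbd.
have m1 (S : set 'rV[R]_n) : measurable S -> measurable_fun setT (\1_S : _ -> R).
  by move=> mS; exact: measurable_indic.
have mshift (h : 'rV[R]_n) : measurable_fun setT (fun x : 'rV[R]_n => psi (x + h)).
  apply: (measurableT_comp mpsi); have := measurable_affine 1 h.
  by congr measurable_fun; apply/funext => x; rewrite scale1r.
have Wpsi k x : ~ W x -> psi (x + t k *: e) = 0.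
  move=> nW; apply: psi0 => Kx; apply: nW.
  exists (x + t k *: e) => //; rewrite mx_norm_ball /ball_/=.
  rewrite addrAC subrr add0r normrZ ger0_norm ?(ltW (t0 k))//.
  apply: (@le_lt_trans _ _ (1 * 1)); last by rewrite mulr1 ltr1n.
  by apply: ler_pM => //; [exact: ltW|exact: le_trans (tc k) c1].
have i1 (S : set 'rV[R]_n) (x : 'rV[R]_n) : `|\1_S x : R| <= 1.
  by rewrite indicE; case: (_ \in _); rewrite ?normr1 ?normr0.
pose f_ k x : \bar R := ((t k)^-1 * (psi (x + t k *: e) - psi x) * \1_F x)%:E.
pose f x : \bar R := (dpsi x * \1_F x)%:E.
pose g x : \bar R := (B * \1_W x)%:E.
have mf_ k : measurable_fun setT (f_ k).
  apply/measurable_EFinP; apply: measurable_funM; last exact: m1.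
  by apply: measurable_funM => //; exact: measurable_funB.
have mf : measurable_fun setT f.
  by apply/measurable_EFinP; apply: measurable_funM => //; exact: m1.
have ig : mu.-integrable setT g.
  apply: (integrable_bounded_support (B := B) _ mW Woo B0).
    by apply: measurable_funM => //; exact: m1.
  move=> x; rewrite normrM !ger0_norm//.
have cvf x : f_ k x @[k --> \oo] --> f x.
  apply/fine_cvgP; split; first exact: nearW.
  apply: cvgM; last exact: cvg_cst.
  exact: (cvg_comp _ _ cvt (dq x)).
have dom k x : (`|f_ k x| <= g x)%E.
  rewrite /f_ /g/= lee_fin; have [Wx|nWx] := pselect (W x).
    rewrite [\1_W x]indicE mem_set// mulr1 normrM.
    apply: (@le_trans _ _ (B * 1)); last by rewrite mulr1.
    apply: ler_pM => //; rewrite normrM normfV (ger0_norm (ltW (t0 k))).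
    rewrite ler_pdivrMl//; have := lip x (t k).
    by rewrite (ger0_norm (ltW (t0 k))) mulrC.
  rewrite Wpsi// psi0; last by move=> /KW.
  by rewrite subr0 mulr0 mul0r normr0 mulr_ge0.
have [fi _ cvI] := dominated_convergence measurableT mf_ mf
  (aeW _ (fun x _ => cvf x)) ig (aeW _ (fun x k _ => dom k x)).
split => //.
have bound k : (\int[mu]_x f_ k x <= L%:E)%E.
  pose a' x : R := psi x * \1_(translate (- (t k *: e)) F) x.
  pose b x : R := psi x * \1_F x.
  have mtF : measurable (translate (- (t k *: e)) F) by exact: measurable_translate.
  have int_psi (S : set 'rV[R]_n) : measurable S ->
      mu.-integrable setT (EFin \o (fun x => psi x * \1_S x)).
    move=> mS; apply: (integrable_bounded_support (B := 1) _ mK) => //.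
    - by apply: measurable_funM => //; exact: m1.
    - exact: compact_borel_lebesgue_fin.
    move=> x; have [Kx|nKx] := pselect (K x).
      rewrite [\1_K x]indicE mem_set// mulr1 normrM.
      by apply: le_trans (ler_pM _ _ (psi1 x) (i1 S x)) _; rewrite ?mulr1.
    by rewrite psi0// mul0r normr0 mulr_ge0.
  have ia' := int_psi _ mtF; have ib := int_psi _ mF.
  pose a x : R := psi (x + t k *: e) * \1_F x.
  have aE x : a x = a' (x + t k *: e).
    rewrite /a /a' !indicE (_ : (_ \in translate _ F) = (x \in F))//.
    by apply/idP/idP; rewrite !inE /translate/= addrK.
  have ia : mu.-integrable setT (EFin \o a).
    apply: (integrable_bounded_support (B := 1) _ mW) => //.
      by apply: measurable_funM => //; exact: m1.
    move=> x; have [Wx|nWx] := pselect (W x).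
      rewrite [\1_W x]indicE mem_set// mulr1 normrM.
      by apply: le_trans (ler_pM _ _ (psi1 _) (i1 F x)) _; rewrite ?mulr1.
    by rewrite /a Wpsi// mul0r normr0 mulr_ge0.
  have -> : (\int[mu]_x f_ k x =
      ((t k)^-1)%:E * (\int[mu]_x (a x)%:E - \int[mu]_x (b x)%:E))%E.
    rewrite -integralB_EFin// -integralZl//; last exact: integrableB.
    apply: eq_integral => x _; rewrite /f_ /a /b -EFinB -EFinM; congr (_%:E).
    by ring.
  have -> : (\int[mu]_x (a x)%:E = \int[mu]_x (a' x)%:E)%E.
    rewrite -(integral_translate (t k *: e) (f := fun x => (a' x)%:E)).
      by apply: eq_integral => x _; rewrite aE.
    exact: measurable_int ia'.
  rewrite -integralB_EFin// lee_pdivrMl// -EFinM mulrC.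
  apply: le_trans (HL (t k) _); last by rewrite t0 (le_lt_trans (tc k)).
  pose J := K `&` (F `+` translate (- (t k *: e)) F).
  have mJ : measurable J by apply: measurableI => //; exact: measurable_jump.
  have -> : jumpvol K F (- (t k *: e)) = (\int[mu]_x (\1_J x)%:E)%E.
    by rewrite integral_indic// setIT.
  apply: le_integral => //; first exact: integrableB.
    apply: (integrable_bounded_support (f := \1_J) (B := 1) _ mK) => //.
    - exact: compact_borel_lebesgue_fin.
    move=> x; rewrite mul1r ger0_norm// !indicE ler_nat.
    by have [/set_mem[Kx _]|//] := boolP (x \in J); rewrite mem_set.
  move=> x _; rewrite -EFinB lee_fin /a' /b -mulrBr.
  have [Kx|nKx] := pselect (K x); last first.
    by rewrite psi0// mul0r.
  have := psi1 x; rewrite ler_norml => /andP[p1 p2].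
  rewrite [\1_J x]indicE.
  have [Jx|nJx] := pselect (J x).
    rewrite (mem_set Jx) !indicE; move: (psi x) p1 p2 => p; clear.
    by case: (_ \in _); case: (_ \in _) => /=; lra.
  rewrite memNset//; have FE : translate (- (t k *: e)) F x <-> F x.
    apply: contrapT => H; apply: nJx; split => //; apply/setY_iff.
    by move: H; tauto.
  by rewrite !indicE (_ : (x \in translate _ F) = (x \in F)) ?subrr ?mulr0//;
    apply/idP/idP; rewrite !inE => /FE.
rewrite -(cvg_lim _ cvI)//; apply: lime_le.
  by apply/cvg_ex; eexists; exact: cvI.
exact: nearW.
Qed.

End flux.

(** * Finite perimeter, and the limit sets of a cluster point *)

Section perimeter_bound.
Context {R : realType} {n : nat}.
Local Notation mu := (@borel_lebesgue R n).
Local Notation leb := (@lebesgue R n).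
Local Notation mleb A := (measurable (A : set (lebesgueType n))).
Local Notation basis i := (delta_mx ord0 i : 'rV[R]_n).

(** Summing the bounds of [partial_derivative_flux] over the n partial derivatives
    bounds the integral of the divergence of any test field by n L. *)
Lemma perimeter_of_jump_bound (F F' O K : set 'rV[R]_n) (L d : R) :
  mleb F -> measurable F' -> {ae leb, forall x, F x <-> F' x} ->
  open O -> compact K -> O `<=` K -> 0 < d ->
  (forall t h, 0 < t < d -> `|h| <= t -> (jumpvol K F' h <= (L * t)%:E)%E) ->
  (perimeter F O < +oo)%E.
Proof.
move=> mF mF' FF' oO cK OK d0 HL.
apply: (@le_lt_trans _ _ (\sum_(i < n) L)%:E); last by rewrite ltry.
apply: ge_ereal_sup => _ [phi [C1phi [K0 [cK0 K0O] phi0] phi1] <-].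
pose D (i : 'I_n) x : R := ('D_(basis i) phi x) ord0 i.
have mD i : measurable_fun setT (D i).
  apply: continuous_measurable_rV => y.
  apply: (@continuous_comp _ _ _ (fun y => 'D_(basis i) phi y)
    (fun M : 'rV[R]_n => M ord0 i)); last exact: coord_continuous.
  by have [_] := C1phi i; exact.
have mO := open_measurable_rV oO.
have flux (i : 'I_n) : mu.-integrable setT (fun x => (D i x * \1_F' x)%:E) /\
    (\int[mu]_x (D i x * \1_F' x)%:E <= L%:E)%E.
  have [B HB] := C1_partials_bounded i C1phi cK0 phi0.
  have B0 : 0 <= B by apply: le_trans (normr_ge0 _) (HB i 0).
  apply: (@partial_derivative_flux _ _ F' K0 (fun x => phi x ord0 i) (D i)
    (basis i) B L d) => //.
  - exact: basis_norm.
  - apply: continuous_measurable_rV.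
    exact: C1_coord_continuous C1phi cK0 phi0.
  - by move=> x; apply: le_trans (coord_le_enorm _ _) (phi1 x).
  - by move=> x nKx; rewrite phi0// mxE.
  - move=> x t; apply: directional_lipschitz; last exact: HB.
    by have [] := C1phi i.
  - move=> x; apply: directional_difference_quotient.
    by have [] := C1phi i.
  - move=> t td; have /andP[t0 _] := td.
    apply: le_trans (HL t (- (t *: basis i)) td _).
      apply: jumpvolS => //; [exact: compact_measurable_rV..|].
      exact: subset_trans K0O OK.
    rewrite normrN normrZ gtr0_norm// -[leRHS]mulr1 ler_pM2l//.
    exact: basis_norm.
have mdiv : measurable_fun setT (divergence phi).
  by apply: measurable_sum => i; exact: mD.
rewrite (integral_lebesgue (B := F' `&` O) (f := fun x => (divergence phi x)%:E))//.
- rewrite integral_mkcond.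
  rewrite (eq_integral (fun x => \sum_(i < n) (D i x * \1_F' x)%:E)%E); last first.
    move=> x _; rewrite patchE sumEFin -mulr_suml.
    rewrite -[X in (X * _)%:E]/(divergence phi x).
    have [Ox|nOx] := pselect (O x); last first.
      rewrite ifF; last by apply/negbTE; rewrite notin_setE => -[].
      rewrite /divergence big1 ?mul0r// => i _.
      by rewrite (derive_outside_support _ cK0 phi0) ?mxE// => /K0O.
    rewrite indicE; have [F'x|nF'x] := pselect (F' x).
      by rewrite !mem_set// mulr1.
    by rewrite !memNset ?mulr0//; case.
  rewrite integral_sum//; last by move=> i; case: (flux i).
  by rewrite -sumEFin; apply: lee_sum => i _; case: (flux i).
- by apply: measurableI => //; exact: open_lebesgue_measurable.
- exact: measurableI.
- by apply: filterS FF' => x xF; rewrite /=; tauto.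
- exact/measurable_EFinP.
Qed.

End perimeter_bound.

Section limit_partition.
Context {R : realType} {n m : nat}.
Local Notation leb := (@lebesgue R n).
Local Notation mleb A := (measurable (A : set (lebesgueType n))).

(** Finitely many coordinates are involved, so that a neighborhood of u for the
    pointwise topology controls all of them at once. *)
Lemma cluster_chi_partition (Omega : set 'rV[R]_n)
    (E : nat -> mpartition m [set: 'rV[R]_n]) (u : {ptws 'I_m -> L1loc Omega}) :
  cluster (chi_partition Omega (E k) @[k --> \oo]) u ->
  forall K (e : R) N, compact K -> K `<=` Omega -> 0 < e ->
    exists2 k, (N <= k)%N & forall i,
      (L1dist K (u i) (chi_partition Omega (E k) i) < e%:E)%E.
Proof.
move=> cu K e N cK KO e0.
have uB : nbhs u [set f : {ptws 'I_m -> L1loc Omega} |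
    forall i, (L1dist K (u i) (f i) < e%:E)%E].
  have near_i (i : 'I_m) : nbhs u [set f : {ptws 'I_m -> L1loc Omega} |
      (L1dist K (u i) (f i) < e%:E)%E].
    apply: (@proj_continuous 'I_m (fun=> L1loc Omega) i u
      [set g | (L1dist K (u i) g < e%:E)%E]).
    by exists K, e; split.
  exact: (@filter_forall _ _ _ (nbhs u) (nbhs_filter u) near_i).
have [|_ [[k Nk <-] H]] := cu [set f | exists2 k, (N <= k)%N &
    chi_partition Omega (E k) = f] _ _ uB.
  by exists N => // k /= Nk; exists k.
by exists k.
Qed.

Lemma le0_of_le_half_powers (x : \bar R) (c : R) (J : nat) :
  (forall j, (J <= j)%N -> (x <= (c / 2 ^+ j)%:E)%E) -> (x <= 0)%E.
Proof.
move=> H; apply/lee_addgt0Pr => e e0; rewrite add0e.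
pose j := maxn J (Num.trunc (c / e)).+1.
apply: le_trans (H j (leq_maxl _ _)) _; rewrite lee_fin.
rewrite ler_pdivrMr ?exprn_gt0// -ler_pdivrMl// mulrC.
apply: ltW; apply: lt_trans (truncnS_gt _) _; rewrite -natrX ltr_nat.
by apply: leq_ltn_trans (ltn_expl j (ltnSn 1)); rewrite leq_maxr.
Qed.

(** Borel-Cantelli lemma on the sets where A j and F differ. *)
Lemma ae_eventually_of_summable (Omega : set 'rV[R]_n) (A : nat -> set 'rV[R]_n)
    (F : set 'rV[R]_n) (c : R) : open Omega -> 0 <= c ->
  (forall j, mleb (A j)) -> mleb F ->
  (forall j, (leb (exhaust Omega j `&` (A j `+` F)) <= (c / 2 ^+ j)%:E)%E) ->
  {ae leb, forall x, Omega x ->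
    exists J, forall j, (J <= j)%N -> A j x <-> F x}.
Proof.
move=> oO c0 mA mF H.
pose D j := exhaust Omega j `&` (A j `+` F).
have mD j : mleb (D j).
  apply: measurableI; last exact: measurableY.
  exact/compact_lebesgue_measurable/exhaust_compact.
have D0 : leb (lim_sup_set D) = 0%E.
  apply: lim_sup_set_cvg0 => //.
  apply: (@le_lt_trans _ _ (2 * c)%:E); last by rewrite ltry.
  apply: lime_le; first exact: is_cvg_nneseries.
  apply: nearW => N; rewrite big_mkord.
  apply: (@le_trans _ _ (\sum_(l < N) (c / 2 ^+ l)%:E)%E).
    by apply: lee_sum => l _; exact: H.
  by rewrite sumEFin lee_fin; exact: half_geometric_sum.
have : leb.-negligible (lim_sup_set D).
  apply/negligibleP => //; apply: bigcapT_measurable => N.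
  exact: bigcup_measurable.
apply: negligibleS => x /not_implyP[Ox nJ] N _; apply: contrapT => nD.
apply: nJ; have [l lx] := exhaust_cover oO Ox.
exists (maxn N l) => j; rewrite geq_max => /andP[Nj lj].
apply: contrapT => nAF; apply: nD; exists j => //; split.
  exact: exhaustS lx.
exact/setY_iff.
Qed.

Lemma L1dist0_ae (Omega K : set 'rV[R]_n) (f g : L1loc Omega) : compact K ->
  K `<=` Omega -> L1dist K f g = 0%E -> {ae leb, forall x, K x -> f x = g x}.
Proof.
move=> cK KO fg0; have mK := compact_lebesgue_measurable cK.
have mh : measurable_fun (K : set (lebesgueType n))
    (fun x : lebesgueType n => (f x - g x)%:E).
  apply/measurable_EFinP; apply: measurable_funB; apply/measurable_EFinP.
    exact: measurable_int (L1loc_fun_integrable f KO cK).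
  exact: measurable_int (L1loc_fun_integrable g KO cK).
have /(ae_eq_integral_abs _ mK mh) : (\int[leb]_(x in K) `|(f x - g x)%:E| = 0)%E.
  exact: fg0.
apply: filterS => x H Kx; have [/eqP] := H Kx.
by rewrite subr_eq0 => /eqP.
Qed.

(** Choose k_j with u at distance less than 2^-j of the k_j-th partition on the j-th
    set of the exhaustion. The chambers then form a fast Cauchy sequence, which
    provides the sets F i; they are also the limits of u, so u i is the
    indicator of F i. *)
Lemma cluster_limit_sets (Omega : set 'rV[R]_n)
    (E : nat -> mpartition m [set: 'rV[R]_n]) (u : {ptws 'I_m -> L1loc Omega}) :
  open Omega ->
  cluster (chi_partition Omega (E k) @[k --> \oo]) u ->
  exists (k : nat -> nat) (F : 'I_m -> set 'rV[R]_n),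
    [/\ forall j, (j <= k j)%N, forall i, mleb (F i),
        forall i j, (leb (exhaust Omega j `&` (E (k j) i `+` F i)) <=
                     (4 / 2 ^+ j)%:E)%E &
        forall i, {ae leb, forall x, Omega x -> u i x = \1_(F i) x}].
Proof.
move=> oO cu.
have cK (j : nat) := @exhaust_compact R n Omega j.
have KO (j : nat) := @exhaust_sub R n Omega j.
have e0 j : 0 < 1 / 2 ^+ j :> R by rewrite divr_gt0// exprn_gt0.
have /choice[k Hk] (j : nat) : exists k, (j <= k)%N /\ forall i,
    (L1dist (exhaust Omega j) (u i) (chi_partition Omega (E k) i) < (1 / 2 ^+ j)%:E)%E.
  by have [k jk Hk] := cluster_chi_partition cu j (cK j) (@KO j) (e0 j); exists k.
have mE l i := partition_measurable (chamberP (E l)) i.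
have /choice[F HF] (i : 'I_m) : exists F, mleb F /\ forall j,
    (leb (exhaust Omega j `&` (E (k j) i `+` F)) <= (2 * (2 / 2 ^+ j))%:E)%E.
  apply: (@fast_cauchy_limsup _ _ Omega (fun j => E (k j) i) (fun j => mE (k j) i)) => // j.
  rewrite -(L1dist_chi Omega (mE (k j) i) (mE (k j.+1) i))//.
  apply: le_trans (L1dist_triangle _ (u i) _ (@KO j) (cK j)) _.
  have h1 : (L1dist (exhaust Omega j) (chi Omega (mE (k j) i)) (u i) <= (1 / 2 ^+ j)%:E)%E.
    by rewrite L1distC; have [_ /(_ i)/ltW] := Hk j.
  have h2 : (L1dist (exhaust Omega j) (u i) (chi Omega (mE (k j.+1) i)) <= (1 / 2 ^+ j)%:E)%E.
    apply: (@le_trans _ _ (L1dist (exhaust Omega j.+1) (u i) (chi Omega (mE (k j.+1) i)))).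
      by apply: L1dist_subset => //; exact: exhaustS.
    have [_ /(_ i)/ltW H2] := Hk j.+1; apply: le_trans H2 _.
    rewrite lee_fin ler_pM2l// lef_pV2 ?posrE ?exprn_gt0//.
    by rewrite exprS ler_peMl ?exprn_ge0// ler1n.
  apply: le_trans (leeD h1 h2) _.
  by rewrite -EFinD lee_fin -mulrDl.
have HF2 i j : (leb (exhaust Omega j `&` (E (k j) i `+` F i)) <= (4 / 2 ^+ j)%:E)%E.
  have [_ /(_ j)] := HF i; rewrite mulrA (_ : 2 * 2 = 4 :> R)//; first by ring.
exists k, F; split => //.
- by move=> j; have [] := Hk j.
- by move=> i; have [] := HF i.
move=> i; have [mFi _] := HF i.
(* on a fixed compact set, the distance of u i to the indicator of F i is at
   most 1 / 2^j + 4 / 2^j for every j >= l *)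
have aeK l : {ae leb, forall x, exhaust Omega l x -> u i x = \1_(F i) x}.
  apply: (@L1dist0_ae Omega _ (u i) (chi Omega mFi)) => //.
  apply/eqP; rewrite eq_le integral_ge0 ?andbT; last by move=> x _; rewrite lee_fin.
  apply: (@le0_of_le_half_powers _ 5 l) => j lj.
  apply: (@le_trans _ _ (L1dist (exhaust Omega j) (u i) (chi Omega mFi))).
    by apply: L1dist_subset => //; exact: exhaustS.
  apply: le_trans (L1dist_triangle _ (chi Omega (mE (k j) i)) _ (@KO j) (cK j)) _.
  rewrite [X in (_ + X)%E]L1dist_chi//.
  have [_ /(_ i)/ltW H2] := Hk j.
  apply: le_trans (leeD H2 (HF2 i j)) _.
  by rewrite -EFinD lee_fin -mulrDl (_ : 1 + 4 = 5 :> R)//; ring.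
have := ae_foralln aeK; apply: filterS => x H Ox.
by have [l lx] := exhaust_cover oO Ox; exact: H lx.
Qed.

End limit_partition.

(** * The limit partition *)

Section limit_jumps.
Context {R : realType} {n : nat}.
Local Notation mu := (@borel_lebesgue R n).
Local Notation leb := (@lebesgue R n).
Local Notation mleb A := (measurable (A : set (lebesgueType n))).

(** Where the jumps of F and E differ, E and F differ at x or at x + h. *)
Lemma jumpvol_perturb (A G E F : set 'rV[R]_n) h :
  measurable A -> measurable G -> measurable E -> measurable F ->
  A `<=` G -> A `<=` translate h G ->
  (jumpvol A F h <= jumpvol A E h +
    (mu (G `&` (E `+` F)) + mu (G `&` (E `+` F))))%E.
Proof.
move=> mA mG mE mF AG AhG; pose D := G `&` (E `+` F).
have mD : measurable D by apply: measurableI => //; exact: measurableY.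
have mJ X : measurable X -> measurable (A `&` (X `+` translate h X)).
  by move=> mX; apply: measurableI => //; exact: measurable_jump.
have mT : measurable (translate h D) by exact: measurable_translate.
rewrite -{2}(borel_lebesgue_translate h mD).
apply: (@le_trans _ _ (mu ((A `&` (E `+` translate h E)) `|` (D `|` translate h D)))).
  apply: le_measure; rewrite ?inE.
  - exact: mJ.
  - by apply: measurableU; [exact: mJ|exact: measurableU].
  move=> x [Ax /setY_iff FF].
  have [EF|/setY_iff EF] := pselect (E x <-> F x); last first.
    by right; left; split => //; exact: AG.
  have [EFh|/setY_iff EFh] := pselect (E (x + h) <-> F (x + h)); last first.
    by right; right; split => //; exact: AhG.
  by left; split => //; apply/setY_iff; rewrite /translate/= in FF *; tauto.
apply: le_trans (measureU2 _ (mJ _ mE) (measurableU _ _ mD mT)) _.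
by rewrite leeD2l//; exact: measureU2.
Qed.

Lemma le_of_powR_limit (x : \bar R) (M r c : R) (a : nat -> R) (J : nat) :
  (0 <= x)%E -> 0 < r -> a j @[j --> \oo] --> (1 : R) ->
  (forall j, (J <= j)%N -> (x <= (M * r `^ a j + c / 2 ^+ j)%:E)%E) ->
  (x <= (M * r)%:E)%E.
Proof.
move=> x0 r0 a1 H.
have xfin : x \is a fin_num.
  by rewrite ge0_fin_numE//; apply: le_lt_trans (H J (leqnn J)) _; rewrite ltry.
rewrite -(fineK xfin) lee_fin.
have cvg : M * r `^ a j + c / 2 ^+ j @[j --> \oo] --> M * r.
  rewrite -[M * r]addr0; apply: cvgD.
    apply: cvgMr; under eq_fun do rewrite /powR gt_eqF//.
    suff : expR (a j * ln r) @[j --> \oo] --> expR (1 * ln r).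
      by rewrite mul1r lnK ?posrE.
    by apply: continuous_cvg; [exact: continuous_expR|exact: cvgMl].
  under eq_fun do rewrite -exprVn.
  by apply: cvg_geometric; rewrite gtr0_norm ?invr_gt0// invf_lt1// ltr1n.
rewrite -(cvg_lim _ cvg)//; apply: limr_ge; first by apply/cvg_ex; exists (M * r).
by exists J => // j Jj; rewrite -lee_fin fineK//; exact: H.
Qed.

(** The bound of [uniform_jump_bounds] at the radius 2t > |h| involves (2t)^(2 s_k),
    and replacing the k_j-th chamber by F costs 2c / 2^j; both converge, and the
    limit is 2 M t. *)
Lemma limit_jump_bound m (Omega K : set 'rV[R]_n) (sigma : 'M[R]_m)
    (s : nat -> R) (E : nat -> mpartition m [set: 'rV[R]_n])
    (k : nat -> nat) (i : 'I_m) (F F' : set 'rV[R]_n) (c : R) :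
  (0 < n)%N -> open Omega -> compact K -> K `<=` Omega ->
  surface_tensions sigma ->
  (forall k, 0 < s k < 1 / 2) -> s k @[k --> \oo] --> (1 / 2 : R) ->
  locally_bounded_energy Omega sigma s E ->
  (forall j, (j <= k j)%N) -> mleb F -> measurable F' ->
  {ae leb, forall x, F x <-> F' x} ->
  (forall j, (leb (exhaust Omega j `&` (E (k j) i `+` F)) <= (c / 2 ^+ j)%:E)%E) ->
  exists L d : R, 0 < d /\
    forall t h, 0 < t < d -> `|h| <= t -> (jumpvol K F' h <= (L * t)%:E)%E.
Proof.
move=> n0 oO cK KO hsig hs slim Eb jk mF mF' FF' Fk.
have [rho rho0 KrO] := compact_nbd_sub cK oO KO.
have [r0 [M [r00 M0 HM]]] := uniform_jump_bounds n0 oO cK KO hsig hs Eb.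
pose G := closure (nbd K (rho / 2)).
have rho2 : rho / 2 < rho by lra.
have [cG GO] : compactly_included (nbd K (rho / 2)) Omega.
  exact: compactly_included_nbd rho2 KrO.
have [J GJ] := sub_exhaust oO cG GO.
have mK := compact_measurable_rV cK; have mG := compact_measurable_rV cG.
exists (M * 2), (Num.min (r0 / 2) (rho / 2)); split.
  by rewrite lt_min !divr_gt0.
move=> t h /andP[t0]; rewrite lt_min => /andP[tr trho] ht.
rewrite -mulrA; apply: (@le_of_powR_limit _ _ _ (2 * c) (fun j => 2 * s (k j)) J).
- exact: measure_ge0.
- by rewrite mulr_gt0.
- suff : 2 * s (k j) @[j --> \oo] --> 2 * (1 / 2 : R).
    by rewrite (_ : 2 * (1 / 2) = 1)//; lra.
  apply: cvgMr; apply: cvg_comp slim => A [N _ NA].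
  by exists N => // j Nj; apply: NA => /=; apply: leq_trans Nj (jk j).
move=> j Jj; have [C [mC EC _ HC]] := HM (k j) i.
have mE := partition_measurable (chamberP (E (k j))) i.
have KG : K `<=` G by apply: subset_trans (@subset_closure _ _); apply: sub_nbd; lra.
have KhG : K `<=` translate h G.
  move=> x Kx; apply: subset_closure; exists x => //.
  rewrite mx_norm_ball /ball_/= opprD addrA subrr sub0r normrN.
  exact: le_lt_trans ht trho.
have GCF : (mu (G `&` (C `+` F')) <= (c / 2 ^+ j)%:E)%E.
  have mGCF : measurable (G `&` (C `+` F')).
    by apply: measurableI => //; exact: measurableY.
  rewrite -lebesgueE//; apply: le_trans (Fk j).
  rewrite (@lebesgue_ae_eq _ _ _ (G `&` (E (k j) i `+` F))).
  - apply: le_measure; rewrite ?inE.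
    + apply: measurableI; first exact: compact_lebesgue_measurable.
      exact: measurableY.
    + apply: measurableI; last exact: measurableY.
      exact/compact_lebesgue_measurable/exhaust_compact.
    + by apply: setSI => x /GJ; exact: exhaustS.
  - exact: borel_lebesgue_measurable.
  - apply: measurableI; first exact: compact_lebesgue_measurable.
    exact: measurableY.
  - apply: filterS2 EC FF' => x ECx FFx; split=> -[Gx /setY_iff H]; split => //;
      apply/setY_iff; tauto.
apply: le_trans (jumpvol_perturb mK mG mC mF' KG KhG) _.
have h1 := HC (2 * t) h.
rewrite (_ : M * _ + _ = M * (2 * t) `^ (2 * s (k j)) + (c / 2 ^+ j + c / 2 ^+ j)).
  rewrite !EFinD; apply: leeD; last exact: leeD.
  apply: h1; first by apply/andP; split; lra.
  by apply: le_lt_trans ht _; lra.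
by congr (_ + _); lra.
Qed.

End limit_jumps.

Section limit_partition.
Context {R : realType} {n m : nat}.
Local Notation leb := (@lebesgue R n).
Local Notation mleb A := (measurable (A : set (lebesgueType n))).

(** At almost every x, each of the finitely many chambers eventually agrees with
    its limit on x, and in each partition x lies in exactly one chamber. *)
Lemma limit_is_mpartition (Omega : set 'rV[R]_n)
    (E : nat -> mpartition m [set: 'rV[R]_n]) (k : nat -> nat)
    (F : 'I_m -> set 'rV[R]_n) (c : R) :
  open Omega -> 0 <= c -> (forall i, mleb (F i)) ->
  (forall i j, (leb (exhaust Omega j `&` (E (k j) i `+` F i)) <=
                (c / 2 ^+ j)%:E)%E) ->
  is_mpartition Omega (fun i => F i `&` Omega).
Proof.
move=> oO c0 mF Fk; have mO := open_lebesgue_measurable oO.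
apply: (is_mpartition_ae oO _ _).2 => [i|i x []//|]; first exact: measurableI.
have mE l i := partition_measurable (chamberP (E l)) i.
have eqv : {ae leb, forall x, forall i, Omega x ->
    exists J, forall j, (J <= j)%N -> E (k j) i x <-> F i x}.
  apply: filter_forall => i.
  by apply: (@ae_eventually_of_summable _ _ _ _ _ c) => // j; exact: mE.
have part : {ae leb, forall x j, exists2 i, E (k j) i x & forall l, E (k j) l x -> l = i}.
  apply: ae_foralln => j.
  have pE := chamberP (E (k j)).
  have := (is_mpartition_ae openT (mE (k j)) (partition_sub pE)).1 pE.
  by apply: filterS => x; exact.
apply: filterS2 eqv part => x eqv part Ox.
have /choice[J HJ] (i : 'I_m) := eqv i Ox.
pose j := (\max_i J i)%N.
have HF i : E (k j) i x <-> F i x by apply: HJ; exact: leq_bigmax.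
have [i Ei Hi] := part j; exists i; first by split => //; exact/HF.
by move=> l [/HF/Hi].
Qed.

Lemma is_mpartition_restrict (O O' : set 'rV[R]_n) (F : 'I_m -> set 'rV[R]_n) :
  open O -> open O' -> O' `<=` O -> is_mpartition O F ->
  is_mpartition O' (fun i => F i `&` O').
Proof.
move=> oO oO' O'O pF; have mF := partition_measurable pF.
apply: (is_mpartition_ae oO' _ _).2 => [i|i x []//|].
  by apply: measurableI => //; exact: open_lebesgue_measurable.
have := (is_mpartition_ae oO mF (partition_sub pF)).1 pF.
apply: filterS => x H O'x; have [i Fi Hi] := H (O'O _ O'x).
by exists i => // l [/Hi].
Qed.

End limit_partition.

Theorem theorem1p1 (R : realType) (n m : nat) (hn : (2 <= n)%N) (hm : (3 <= m)%N)
    (Omega : set 'rV[R]_n) (Omega_open : open Omega)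
    (Omega_bounded : bounded_set Omega)
    (Omega_lipschitz : lipschitz_boundary Omega)
    (sigma : 'M[R]_m) (hsigma : surface_tensions sigma)
    (s : nat -> R) (hs : forall k, 0 < s k < 1 / 2)
    (s_lim : s k @[k --> \oo] --> (1 / 2 : R))
    (E : nat -> mpartition m [set: 'rV[R]_n])
    (hE : forall k, admissible_partitions sigma (s k) Omega (E k))
    (E_bounded : forall Omega', open Omega' -> compactly_included Omega' Omega ->
      (ereal_sup (range (fun k =>
         (1 - 2 * s k)%:E * inner_energy sigma (s k) (E k) Omega')) < +oo)%E) :
  precompact (range (fun k => chi_partition Omega (E k))) /\
  forall u : {ptws 'I_m -> L1loc Omega},
    cluster (chi_partition Omega (E k) @[k --> \oo]) u ->
    exists F : mpartition m Omega,
      (forall i, {ae @lebesgue R n,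
         forall x, Omega x -> u i x = \1_(F i) x}) /\
      forall Omega', open Omega' -> compactly_included Omega' Omega ->
        caccioppoli_partition Omega' (fun i => F i `&` Omega').
Proof.
have n0 : (0 < n)%N by exact: ltnW.
split; first exact: precompact_chambers n0 Omega_open hsigma hs s_lim E_bounded.
move=> u /(cluster_limit_sets Omega_open)[k [F [jk mF Fk uF]]].
have pF := @limit_is_mpartition _ _ _ _ _ _ _ 4 Omega_open (ler0n _ 4) mF Fk.
exists (MPartition pF); split=> [i|O oO [cO clO]] /=.
  apply: filterS (uF i) => x H Ox; rewrite H// !indicE; congr (_%:R).
  by congr (nat_of_bool _); apply/idP/idP; rewrite !inE /=; tauto.
have OOmega : O `<=` Omega by exact: subset_trans (@subset_closure _ _) clO.
split; first exact: is_mpartition_restrict Omega_open oO OOmega pF.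
move=> i.
have [F' mF' FF'] := lebesgue_borel_hull (mF i).
have [L [d [d0 HL]]] := limit_jump_bound n0 Omega_open cO clO hsigma hs s_lim
  E_bounded jk (mF i) mF' FF' (Fk i).
have -> : perimeter (F i `&` Omega `&` O) O = perimeter (F i) O.
  rewrite /perimeter; congr (ereal_sup (image _ _)); apply/funext => phi.
  congr (integral _ _ _); apply/seteqP; split=> x.
    by move=> [[[]]].
  by move=> [Fx Ox]; do 2!split => //; split => //; exact: OOmega.
exact: perimeter_of_jump_bound (mF i) mF' FF' oO cO (@subset_closure _ O) d0 HL.
Qed.
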